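(* For any $r\ge1$, there is an $r$-approximation algorithm for the maximum induced matching problem (on general graphs) that runs in time $2^{(n/r)\log\Delta}\mathrm{poly}(n)$, where $n$ is the size (number of vertices) of the input graph and $\Delta$ its maximum degree.
   Context: An induced matching in a graph $G$ is a matching $M$ such that for any two distinct edges $uu',vv'\in M$, $G$ contains none of the edges $uv,uv',u'v,u'v'$. The maximum induced matching problem asks for an induced matching of maximum cardinality. *)

(* Defs.v *)
From mathcomp Require Import all_boot all_order all_algebra.

Set Implicit Arguments.
Unset Strict Implicit.
Unset Printing Implicit Defensive.

Import Order.TTheory GRing.Theory Num.Theory.

Local Open Scope nat_scope.

Record sgraph (n : nat) := SGraph {
  adj :> rel 'I_n;
  adj_sym : symmetric adj;
  adj_irr : irreflexive adj }.

Definition edges (n : nat) (G : sgraph n) : {set {set 'I_n}} :=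
  [set [set p.1; p.2] | p : 'I_n * 'I_n & G p.1 p.2].

Definition maxdeg (n : nat) (G : sgraph n) : nat := \max_(v : 'I_n) #|[set u | G v u]|.

Definition matching (n : nat) (G : sgraph n) (M : {set {set 'I_n}}) : bool :=
  (M \subset edges G) && trivIset M.

Definition induced_matching (n : nat) (G : sgraph n) (M : {set {set 'I_n}}) : bool :=
  matching G M &&
  [forall e in M, forall f in M, (e != f) ==>
     [forall u in e, forall v in f, ~~ G u v]].

Definition max_induced_matching (n : nat) (G : sgraph n) : nat :=
  \max_(M : {set {set 'I_n}} | induced_matching G M) #|M|.

(* Running times refer to the random access machine with logarithmic cost
   (Aho, Hopcroft and Ullman), with structured control flow.  The memory is
   split into arrays: [Cell a e] is the cell of array [a] whose index is the
   value of [e].  Array names are static, so a program only uses finitely many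
   arrays; interleaving them gives a single memory.  All cells hold natural
   numbers of arbitrary size, and every access or operation is charged the bit
   lengths of the numbers (including addresses) that it handles. *)

Inductive binop := Add | Sub | Mul | Div.

Inductive expr :=
| Lit of nat
| Cell of nat & expr
| Bin of binop & expr & expr.

(* [Assign a i e] stores [e] into cell [i] of array [a]; conditions hold when
   their value is nonzero. *)
Inductive prog :=
| Skip
| Assign of nat & expr & expr
| Seq of prog & prog
| If of expr & prog & prog
| While of expr & prog.

Definition state := nat -> nat -> nat.

Definition update (s : state) (a k x : nat) : state :=
  fun b l => if (b == a) && (l == k) then x else s b l.

(* [Sub] is truncated, and division by zero gives 0. *)
Definition binop_eval (o : binop) : nat -> nat -> nat :=
  match o with
  | Add => addn
  | Sub => subn
  | Mul => muln
  | Div => divn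
  end.

Fixpoint eval (s : state) (e : expr) : nat :=
  match e with
  | Lit k => k
  | Cell a i => s a (eval s i)
  | Bin o e1 e2 => binop_eval o (eval s e1) (eval s e2)
  end.

Definition bitlen (k : nat) : nat := (trunc_log 2 k).+1.

Fixpoint cost (s : state) (e : expr) : nat :=
  match e with
  | Lit k => bitlen k
  | Cell a i => cost s i + bitlen (eval s i) + bitlen (s a (eval s i))
  | Bin o e1 e2 =>
      cost s e1 + cost s e2 + bitlen (eval s e1) + bitlen (eval s e2)
  end.

(* [exec c s t s']: started in [s], the program [c] halts in [s'] after time
   [t].  This is deterministic, and fails for all [t] and [s'] on divergence. *)
Inductive exec : prog -> state -> nat -> state -> Prop :=
| exec_skip s : exec Skip s 1 s
| exec_assign s a i e :
    exec (Assign a i e) s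
      (cost s i + cost s e + bitlen (eval s i) + bitlen (eval s e))
      (update s a (eval s i) (eval s e))
| exec_seq c1 c2 s1 s2 s3 t1 t2 :
    exec c1 s1 t1 s2 -> exec c2 s2 t2 s3 -> exec (Seq c1 c2) s1 (t1 + t2) s3
| exec_if_true e c1 c2 s s' t :
    eval s e != 0 -> exec c1 s t s' ->
    exec (If e c1 c2) s (cost s e + bitlen (eval s e) + t) s'
| exec_if_false e c1 c2 s s' t :
    eval s e = 0 -> exec c2 s t s' ->
    exec (If e c1 c2) s (cost s e + bitlen (eval s e) + t) s'
| exec_while_true e c s1 s2 s3 t1 t2 :
    eval s1 e != 0 -> exec c s1 t1 s2 -> exec (While e c) s2 t2 s3 ->
    exec (While e c) s1 (cost s1 e + bitlen (eval s1 e) + t1 + t2) s3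
| exec_while_false e c s :
    eval s e = 0 -> exec (While e c) s (cost s e + bitlen (eval s e)) s.

(* The input is the number of vertices (in cell 0 of array 0) and the adjacency
   matrix, stored by rows in array 1; all other cells are 0. *)
Definition input (n : nat) (G : sgraph n) : state := fun a k =>
  match a with
  | 0 => if k == 0 then n else 0
  | 1 => [exists i : 'I_n, exists j : 'I_n, (k == i * n + j) && G i j]
  | _ => 0
  end.

(* The output is a set of pairs, read off from the n x n matrix in array 2; a
   nonzero diagonal entry yields a singleton, which is never an edge. *)
Definition output (n : nat) (s : state) : {set {set 'I_n}} :=
  [set [set p.1; p.2] | p : 'I_n * 'I_n & s 2 (p.1 * n + p.2) != 0].

(* Required only here: [classical_sets] overrides the [finset] notations. *)
From mathcomp Require Import reals exp.

Local Open Scope ring_scope.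

(* As [ln 0 = 0], the value at 0 (the maximum degree of an edgeless graph)
   is 0. *)
Definition log2 (R : realType) (x : R) : R := ln x / ln 2.

Definition approximates (R : realType) (r : R) (n : nat) (G : sgraph n)
    (M : {set {set 'I_n}}) : Prop :=
  induced_matching G M /\ (max_induced_matching G)%:R <= r * #|M|%:R.

(* [A] is an r-approximation algorithm for maximum induced matching; its running
   time on a graph G with n vertices is at most [T n (maxdeg G)]. *)
Definition approx_algorithm (R : realType) (r : R) (A : prog)
    (T : nat -> nat -> R) : Prop :=
  forall (n : nat) (G : sgraph n), exists (t : nat) (s : state),
    [/\ exec A (input G) t s,
        approximates r G (output n s)
      & t%:R <= T n (maxdeg G)].

(* Main.v *)
(* Proof idea.  Let k be the size of a maximum induced matching M and D the
   maximum degree.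

   If D <= 2, the problem is solved exactly in polynomial time: an edge at a
   vertex of degree 1 can always be picked, and when there is none, all
   components are cycles or isolated vertices, and any vertex of a cycle can be
   deleted, as M can be rotated along the cycle.

   If D >= 3, the vertices are processed in cyclic order from a guessed starting
   point; each vertex not yet dominated by a picked edge is either left unmatched
   or matched to one of its at most D neighbours, as guessed.  By the cycle lemma
   there is a starting point from which following M meets, in every initial
   segment, a proportion of uncovered vertices not above the overall one.  Hence
   when k/rho edges have been picked, for a rational rho <= r close to r, the
   numbers h and z of matched and unmatched guesses satisfy 2h + z <= n/rho + 2.
   These guesses are coded by a number below 2^(z+h) D^h, which is at most
   (2D)^(h+z/2) up to rounding, about (2D)^(n/(2 rho)).  For D >= 3 this is at
   most D^(n/r), because rho can be taken within a factor 11/10 of r; this slack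
   is what makes an irrational r harmless. *)

Require Import Defs.
From mathcomp Require Import all_boot all_order all_algebra zify.

Set Implicit Arguments.
Unset Strict Implicit.
Unset Printing Implicit Defensive.

Local Open Scope nat_scope.

(** * Verification of programs *)

(** Exponent of the bound [W ^ vsize e] on values when cells and literals are at most [W]. A cell
    counts once whatever its address, since its content is at most [W]. *)
Fixpoint vsize (e : expr) : nat :=
  match e with
  | Lit _ | Cell _ _ => 1
  | Bin _ e1 e2 => vsize e1 + vsize e2
  end.

Fixpoint ecost (e : expr) : nat :=
  match e with
  | Lit _ => 1
  | Cell _ i => ecost i + vsize i + 1
  | Bin _ e1 e2 => ecost e1 + ecost e2 + vsize e1 + vsize e2
  end.

Fixpoint max_lit (e : expr) : nat :=
  match e with
  | Lit k => k
  | Cell _ i => max_lit i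
  | Bin _ e1 e2 => maxn (max_lit e1) (max_lit e2)
  end.

Definition bounded (W : nat) (s : state) := forall a k, s a k <= W.

Lemma bitlen_mono k l : k <= l -> bitlen k <= bitlen l.
Proof. by move=> kl; rewrite /bitlen ltnS leq_trunc_log. Qed.

(** From [W < 2 ^ bitlen W] follows [W ^ m < 2 ^ (m * bitlen W)]. *)
Lemma bitlen_exp W m : 0 < m -> bitlen (W ^ m) <= m * bitlen W.
Proof.
move=> m0; have W2 : W < 2 ^ bitlen W by apply: trunc_log_ltn.
case: (posnP W) => [->|W0]; first by rewrite exp0n // /bitlen trunc_log0 muln1.
rewrite {1}/bitlen -(ltn_exp2l _ _ (ltnSn 1)).
apply: leq_ltn_trans (trunc_logP _ _) _; rewrite ?expn_gt0 ?W0 //.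
by rewrite mulnC expnM ltn_exp2r.
Qed.

Lemma vsize_gt0 e : 0 < vsize e.
Proof. by elim: e => //= o e1 h1 e2 _; rewrite addn_gt0 h1. Qed.

(** Both powers of [W] are at least 2, so a sum is bounded by the product; this is where [1 < W]
    enters. *)
Lemma eval_le W s e : 1 < W -> bounded W s -> max_lit e <= W ->
  eval s e <= W ^ vsize e.
Proof.
move=> W1 Ws; elim: e => /= [k|a i _|o e1 IH1 e2 IH2]; rewrite ?expn1 //.
rewrite geq_max => /andP[/IH1 h1 /IH2 h2].
have p1 : 1 < W ^ vsize e1 by rewrite -(exp1n (vsize e1)) ltn_exp2r ?vsize_gt0.
have p2 : 1 < W ^ vsize e2 by rewrite -(exp1n (vsize e2)) ltn_exp2r ?vsize_gt0.
rewrite expnD; case: o => /=; [nia|nia|exact: leq_mul|].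
apply: leq_trans (leq_div _ _) _; nia.
Qed.

Lemma bitlen_eval W s e : 1 < W -> bounded W s -> max_lit e <= W ->
  bitlen (eval s e) <= vsize e * bitlen W.
Proof.
move=> W1 Ws le; apply: leq_trans (bitlen_exp W (vsize_gt0 e)).
exact/bitlen_mono/eval_le.
Qed.

Lemma cost_le W s e : 1 < W -> bounded W s -> max_lit e <= W ->
  cost s e <= ecost e * bitlen W.
Proof.
move=> W1 Ws; elim: e => /= [k|a i IH|o e1 IH1 e2 IH2] le.
- by rewrite mul1n bitlen_mono.
- have := IH le; have := bitlen_eval W1 Ws le.
  have := bitlen_mono (Ws a (eval s i)); nia.
move: le; rewrite geq_max => /andP[l1 l2].
have := IH1 l1; have := IH2 l2.
have := bitlen_eval W1 Ws l1; have := bitlen_eval W1 Ws l2; nia.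
Qed.

(** * Time-bounded triples and framing *)

Fixpoint written (c : prog) : seq nat :=
  match c with
  | Skip => [::]
  | Assign a _ _ => [:: a]
  | Seq c1 c2 | If _ c1 c2 => written c1 ++ written c2
  | While _ c => written c
  end.

Definition frame (l : seq nat) (s s' : state) :=
  forall b, b \notin l -> s' b = s b.

Lemma frame_trans l s1 s2 s3 : frame l s1 s2 -> frame l s2 s3 -> frame l s1 s3.
Proof. by move=> f g b bl; rewrite g ?f. Qed.

Lemma frame_sub l l' s s' : {subset l <= l'} -> frame l s s' -> frame l' s s'.
Proof. by move=> ll f b bl; apply: f; apply: contra bl => /ll. Qed.

Lemma frame_update s a k x : frame [:: a] s (update s a k x).
Proof.
by move=> b; rewrite inE /update => /negPf ->.
Qed.

Lemma exec_frame c s t s' : exec c s t s' -> frame (written c) s s'.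
Proof.
elim=> //= {c s t s'}.
- by move=> s a i e; apply: frame_update.
- move=> c1 c2 s1 s2 s3 _ _ _ h1 _ h2; apply: (@frame_trans _ _ s2).
    by apply: frame_sub h1 => x; rewrite mem_cat => ->.
  by apply: frame_sub h2 => x; rewrite mem_cat => ->; rewrite orbT.
- by move=> e c1 c2 s s' _ _ _; apply: frame_sub => x; rewrite mem_cat => ->.
- by move=> e c1 c2 s s' _ _ _; apply: frame_sub => x; rewrite mem_cat orbC => ->.
- by move=> e c s1 s2 s3 _ _ _ _ h1 _; apply: frame_trans.
Qed.

(* Measuring time in units of [bitlen W], where [W] bounds all cells, reduces the
   logarithmic cost to a count of steps. *)
Definition triple (W : nat) (c : prog) (T : nat) (s : state) (Q : state -> Prop) :=
  exists t s', [/\ exec c s t s', t <= T * bitlen W, bounded W s' & Q s'].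

Lemma bounded_update W s a k x : bounded W s -> x <= W -> bounded W (update s a k x).
Proof. by move=> Ws xW b l; rewrite /update; case: ifP. Qed.

Lemma triple_skip W T s (Q : state -> Prop) :
  bounded W s -> 0 < T -> Q s -> triple W Skip T s Q.
Proof.
move=> Ws T0 Qs; exists 1, s; split=> //; first exact: exec_skip.
by rewrite muln_gt0 T0.
Qed.

Lemma triple_assign W T s a i e (Q : state -> Prop) :
  1 < W -> bounded W s -> max_lit i <= W -> max_lit e <= W -> eval s e <= W ->
  ecost i + ecost e + vsize i + vsize e <= T ->
  Q (update s a (eval s i) (eval s e)) -> triple W (Assign a i e) T s Q.
Proof.
move=> W1 Ws li le eW hT HQ; exists (cost s i + cost s e + bitlen (eval s i) + bitlen (eval s e)),
  (update s a (eval s i) (eval s e)); split=> //; first exact: exec_assign.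
- have := cost_le W1 Ws li; have := cost_le W1 Ws le.
  have := bitlen_eval W1 Ws li; have := bitlen_eval W1 Ws le; nia.
- exact: bounded_update.
Qed.

Lemma triple_seq W c1 c2 T1 T2 T s (Q1 Q : state -> Prop) :
  triple W c1 T1 s Q1 ->
  (forall s1, bounded W s1 -> frame (written c1) s s1 -> Q1 s1 ->
     triple W c2 T2 s1 Q) ->
  T1 + T2 <= T -> triple W (Seq c1 c2) T s Q.
Proof.
move=> [t1 [s1 [e1 ht1 b1 q1]]] /(_ s1 b1 (exec_frame e1) q1).
move=> [t2 [s2 [e2 ht2 b2 q2]]] hT.
exists (t1 + t2), s2; split=> //; first exact: exec_seq e1 e2.
by apply: leq_trans (leq_mul hT (leqnn _)); rewrite mulnDl leq_add.
Qed.

Lemma triple_conseq W c T1 T s (Q1 Q : state -> Prop) :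
  triple W c T1 s Q1 -> T1 <= T ->
  (forall s1, bounded W s1 -> frame (written c) s s1 -> Q1 s1 -> Q s1) ->
  triple W c T s Q.
Proof.
move=> [t1 [s1 [e1 ht1 b1 q1]]] hT /(_ s1 b1 (exec_frame e1) q1) q.
by exists t1, s1; split=> //; apply: leq_trans ht1 _; rewrite leq_mul2r hT orbT.
Qed.

Lemma triple_if W e c1 c2 Tb T s (Q : state -> Prop) :
  1 < W -> bounded W s -> max_lit e <= W ->
  (eval s e != 0 -> triple W c1 Tb s Q) ->
  (eval s e = 0 -> triple W c2 Tb s Q) ->
  ecost e + vsize e + Tb <= T -> triple W (If e c1 c2) T s Q.
Proof.
move=> W1 Ws le h1 h2 hT.
have := cost_le W1 Ws le; have := bitlen_eval W1 Ws le => l1 l2.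
case: (eqVneq (eval s e) 0) => [e0|e0].
  have [t1 [s1 [e1 ht1 b1 q1]]] := h2 e0.
  exists (cost s e + bitlen (eval s e) + t1), s1; split=> //; last nia.
  exact: exec_if_false e1.
have [t1 [s1 [e1 ht1 b1 q1]]] := h1 e0.
exists (cost s e + bitlen (eval s e) + t1), s1; split=> //; last nia.
exact: exec_if_true e1.
Qed.

Definition Var (a : nat) : expr := Cell a (Lit 0).

(** The counter is decremented before the body runs, so the body sees the values from [m - 1] down
    to 0, where [m] is the initial value of [e]. *)
Definition For (x : nat) (e : expr) (c : prog) : prog :=
  Seq (Assign x (Lit 0) e)
      (While (Var x) (Seq (Assign x (Lit 0) (Bin Defs.Sub (Var x) (Lit 1))) c)).

(** [I i] holds when [i] rounds remain. Framing gives each round the arrays that the loop does not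
    write as they were in [s], so invariants need not mention them. The overhead of 14 per round is
    4 for the test and 10 for the decrement. *)
Lemma triple_for W x e c Tb T m (I : nat -> state -> Prop) s :
  1 < W -> x \notin written c -> max_lit e <= W -> bounded W s ->
  eval s e = m -> m <= W ->
  I m (update s x 0 m) ->
  (forall i s1, i < m -> bounded W s1 -> frame (x :: written c) s s1 ->
     I i.+1 s1 -> triple W c Tb (update s1 x 0 i) (I i)) ->
  m * (Tb + 14) + ecost e + vsize e + 6 <= T ->
  triple W (For x e c) T s (I 0).
Proof.
move=> W1 xc le Ws em mW Im step hT.
rewrite /For; set w := While _ _.
suff loop : forall k s1, k <= m -> bounded W s1 -> frame (x :: written c) s s1 ->
    s1 x 0 = k -> I k s1 -> triple W w (k * (Tb + 14) + 4) s1 (I 0).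
  apply: (@triple_seq _ _ _ (ecost e + vsize e + 2) (m * (Tb + 14) + 4) _ _
      (fun s1 => s1 = update s x 0 m)); last by lia.
    by apply: triple_assign => //=; rewrite ?em //; lia.
  move=> s1 b1 _ ->; apply: loop; rewrite ?leqnn //.
  - exact: bounded_update.
  - by apply: frame_sub (@frame_update _ _ _ _) => b; rewrite !inE => ->.
  - by rewrite /update !eqxx.
elim=> [|k IH] s1 km b1 f1 s1x Ik.
  exists (cost s1 (Var x) + bitlen (eval s1 (Var x))), s1; split=> //.
    exact: exec_while_false.
  have := @cost_le W s1 (Var x) W1 b1 (leq0n _).
  have := @bitlen_eval W s1 (Var x) W1 b1 (leq0n _) => /=; lia.
have [t2 [s2 [e2 ht2 b2 q2]]] := step k s1 km b1 f1 Ik.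
set dec := Assign x (Lit 0) (Bin Defs.Sub (Var x) (Lit 1)).
have dec_eq : update s1 x 0 k = update s1 x (eval s1 (Lit 0)) (eval s1 (Bin Defs.Sub (Var x) (Lit 1))).
  by rewrite /= s1x subSS subn0.
have e1 := exec_assign s1 x (Lit 0) (Bin Defs.Sub (Var x) (Lit 1)).
rewrite -dec_eq in e1.
have f2 : frame (x :: written c) s s2.
  apply: frame_trans f1 _; apply: (@frame_trans _ _ (update s1 x 0 k)).
    by apply: frame_sub (@frame_update _ _ _ _) => b; rewrite !inE => ->.
  by apply: frame_sub (exec_frame e2) => b; rewrite inE => ->; rewrite orbT.
have s2x : s2 x 0 = k by rewrite (exec_frame e2) // /update !eqxx.
have [t3 [s3 [e3 ht3 b3 q3]]] := IH s2 (ltnW km) b2 f2 s2x q2.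
have ne : eval s1 (Var x) != 0 by rewrite /= s1x.
have e4 := exec_while_true ne (exec_seq e1 e2) e3.
eexists; exists s3; split; [exact: e4 | | exact: b3 | exact: q3].
have c1 := @cost_le W s1 (Var x) W1 b1 (leq0n _).
have c2 := @bitlen_eval W s1 (Var x) W1 b1 (leq0n _).
have c3 := @cost_le W s1 (Bin Defs.Sub (Var x) (Lit 1)) W1 b1 (ltnW W1).
have c4 := @bitlen_eval W s1 (Bin Defs.Sub (Var x) (Lit 1)) W1 b1 (ltnW W1).
have c5 := @cost_le W s1 (Lit 0) W1 b1 (leq0n _).
have c6 := @bitlen_eval W s1 (Lit 0) W1 b1 (leq0n _).
move: c1 c2 c3 c4 c5 c6 ht2 ht3.
rewrite [ecost (Var x)]/= [vsize (Var x)]/= [ecost (Lit 0)]/= [vsize (Lit 0)]/=.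
rewrite [ecost (Bin _ _ _)]/= [vsize (Bin _ _ _)]/=.
move: (cost _ _) (cost _ _) (cost _ _) (bitlen _) (bitlen _) (bitlen _) (bitlen _).
nia.
Qed.

(* The counter of [For] runs downwards, hence the [rev]. *)
Lemma triple_for_fold n W x e c Tb T (A : Type) (R : A -> state -> Prop)
    (F : A -> 'I_n -> A) a0 s :
  1 < W -> x \notin written c -> max_lit e <= W -> bounded W s ->
  eval s e = n -> n <= W ->
  R a0 (update s x 0 n) ->
  (forall (i : 'I_n) a s1, bounded W s1 -> frame (x :: written c) s s1 ->
     R a s1 -> triple W c Tb (update s1 x 0 i) (R (F a i))) ->
  n * (Tb + 14) + ecost e + vsize e + 6 <= T ->
  triple W (For x e c) T s (R (foldl F a0 (rev (enum 'I_n)))).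
Proof.
move=> W1 xc le Ws en nW R0 step hT.
have -> : enum 'I_n = drop 0 (enum 'I_n) by rewrite drop0.
apply: (@triple_for W x e c Tb T n (fun i => R (foldl F a0 (rev (drop i (enum 'I_n)))))) => //.
  by rewrite drop_oversize // size_enum_ord.
move=> i s1 im b1 f1 Ri.
have -> : drop i (enum 'I_n) = Ordinal im :: drop i.+1 (enum 'I_n).
  rewrite (drop_nth (Ordinal im)) ?size_enum_ord //; congr (_ :: _).
  by apply: val_inj; rewrite /= nth_enum_ord.
rewrite rev_cons foldl_rcons.
exact: (step (Ordinal im) _ s1 b1 f1 Ri).
Qed.

(** * Induced matchings *)

Section Graph.

Variables (n : nat) (G : sgraph n).
Implicit Types (A B : {set 'I_n}) (M : {set {set 'I_n}}) (E : seq ('I_n * 'I_n)).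

Definition nbr (v : 'I_n) : {set 'I_n} := [set u | G v u].

Lemma induced_matchingP M :
  reflect ((forall e, e \in M -> exists u v, G u v /\ e = [set u; v]) /\
           (forall e f, e \in M -> f \in M -> e != f ->
              forall u v, u \in e -> v \in f -> u != v /\ ~~ G u v))
          (induced_matching G M).
Proof.
apply: (iffP andP) => [[/andP[/subsetP Me /trivIsetP Mt] /forall_inP MI]|[Me MI]].
  split=> [e /Me /imsetP[[u v] /= uv ->]|e f eM fM ef u v ue vf].
    by exists u, v; split=> //; move: uv; rewrite inE.
  have /forall_inP/(_ f fM)/implyP/(_ ef)/forall_inP/(_ u ue)/forall_inP/(_ v vf) uv :=
    MI e eM.
  split=> //; apply: contraTneq ue => ->.
  by apply/negP => ve; move: (Mt e f eM fM ef); rewrite -setI_eq0 => /eqP/setP/(_ v);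
     rewrite !inE ve vf.
split; last first.
  apply/forall_inP => e eM; apply/forall_inP => f fM; apply/implyP => ef.
  by apply/forall_inP => u ue; apply/forall_inP => v vf; case: (MI e f eM fM ef u v ue vf).
apply/andP; split.
  apply/subsetP => e /Me[u [v [uv ->]]]; apply/imsetP; exists (u, v) => //.
  by rewrite inE.
apply/trivIsetP => e f eM fM ef; rewrite -setI_eq0; apply/eqP/setP => x; rewrite !inE.
apply/negP => /andP[xe xf]; have [] := MI e f eM fM ef x x xe xf.
by rewrite eqxx.
Qed.

Lemma induced_sub M M' : M' \subset M -> induced_matching G M -> induced_matching G M'.
Proof.
move=> /subsetP MM /induced_matchingP[h1 h2]; apply/induced_matchingP.
split=> [e /MM/h1 //|e f /MM eM /MM fM]; exact: h2.
Qed.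

Lemma induced_set0 : induced_matching G set0.
Proof. by apply/induced_matchingP; split=> [e|e f]; rewrite inE. Qed.

(** Since [u] and [v] are adjacent, [nbr u :|: nbr v] contains both; avoiding it makes the new edge
    disjoint from the others as well as not adjacent to them. *)
Lemma induced_add M u v : induced_matching G M -> G u v ->
  [disjoint cover M & nbr u :|: nbr v] ->
  induced_matching G ([set u; v] |: M) /\ [set u; v] \notin M.
Proof.
move=> /induced_matchingP[h1 h2] uv; rewrite -setI_eq0 => /eqP/setP dis.
have far f x : f \in M -> x \in f -> ~~ G u x && ~~ G v x.
  move=> fM xf; have := dis x; rewrite !inE -negb_or => /negbT; rewrite negb_and.
  by case/orP=> // /bigcupP[]; exists f.
have nonE f x : f \in M -> x \in f -> (x != u) && (x != v).
  move=> fM xf; have /andP[ux vx] := far f x fM xf.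
  by apply/andP; split; [apply: contraNneq vx | apply: contraNneq ux] => -> //;
    rewrite adj_sym.
split; last first.
  apply/negP => eM; have := nonE _ u eM; rewrite !inE eqxx => /(_ isT) //.
apply/induced_matchingP; split.
  by move=> e; rewrite !inE => /orP[/eqP ->|/h1 //]; exists u, v.
move=> e f; rewrite !inE => /orP[/eqP ->|eM] /orP[/eqP ->|fM] ef x y.
- by rewrite eqxx in ef.
- move=> + yf; have /andP[ny ny'] := nonE f y fM yf.
  have /andP[fy fy'] := far f y fM yf.
  by rewrite !inE => /orP[] /eqP ->; rewrite eq_sym.
- move=> xf; have /andP[ny ny'] := nonE e x eM xf.
  have /andP[fy fy'] := far e x eM xf.
  by rewrite !inE => /orP[] /eqP ->; rewrite adj_sym.
exact: h2.
Qed.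

(** Adjacent covered vertices cannot lie in different edges of [M]. *)
Lemma induced_adj M e x y : induced_matching G M -> e \in M -> x \in e ->
  G x y -> y \in cover M -> e = [set x; y].
Proof.
move=> /induced_matchingP[h1 h2] eM xe xy /bigcupP[f fM yf].
have [ef|ef] := eqVneq e f; last by have [] := h2 e f eM fM ef x y xe yf; rewrite xy.
subst f; have [u [v [uv eE]]] := h1 e eM.
have xny : x != y by apply: contraTneq xy => ->; rewrite adj_irr.
move: xe yf xny; rewrite eE !inE => /orP[]/eqP-> /orP[]/eqP->; rewrite ?eqxx //.
by rewrite setUC.
Qed.

(** The vertices dominated by [E]; when [E] consists of edges of [G], they include the endpoints. *)
Definition edge_nbr E : {set 'I_n} :=
  [set w | has (fun p => G p.1 w || G p.2 w) E].

Definition edge_set E : {set {set 'I_n}} := [set [set p.1; p.2] | p in E].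

(** Induced matchings in the order of picking, latest edge first: each edge avoids what the earlier
    ones dominate. *)
Fixpoint imatching E : bool :=
  if E is p :: E' then
    [&& G p.1 p.2, p.1 \notin edge_nbr E', p.2 \notin edge_nbr E' & imatching E']
  else true.

Lemma edge_nbr_cons p E :
  edge_nbr (p :: E) = nbr p.1 :|: nbr p.2 :|: edge_nbr E.
Proof. by apply/setP => x; rewrite !inE. Qed.

Lemma edge_set_cons p E : edge_set (p :: E) = [set p.1; p.2] |: edge_set E.
Proof.
apply/setP => e; rewrite !inE; apply/imsetP/orP => [[q]|].
  rewrite inE => /orP[/eqP -> -> //|qE ->]; first by left.
  by right; apply/imsetP; exists q.
case=> [/eqP ->|/imsetP[q qE ->]]; first by exists p; rewrite ?inE ?eqxx.
by exists q; rewrite // inE qE orbT.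
Qed.

Lemma imatching_induced E : imatching E ->
  [/\ induced_matching G (edge_set E), #|edge_set E| = size E
    & cover (edge_set E) \subset edge_nbr E].
Proof.
elim: E => [_|[u v] E IH /= /and4P[uv uE vE /IH[h1 h2 /subsetP h3]]].
  have -> : edge_set [::] = set0.
    by apply/setP => e; rewrite inE; apply/imsetP => -[].
  by rewrite induced_set0 cards0 /cover big_set0 sub0set.
have dis : [disjoint cover (edge_set E) & nbr u :|: nbr v].
  rewrite -setI_eq0; apply/eqP/setP => x; rewrite !inE.
  apply/negP => /andP[/bigcupP[f /imsetP[p pE ->]]].
  rewrite !inE => xp xuv; move: uE vE; rewrite !inE -!all_predC.
  move=> /allP/(_ p pE) /= uE /allP/(_ p pE) /= vE.
  by case/orP: xp xuv uE vE => /eqP ->; rewrite !(adj_sym G p.1) !(adj_sym G p.2);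
    case: (G u _); case: (G v _); rewrite ?orbT.
have [h4 h5] := induced_add h1 uv dis.
rewrite edge_set_cons /= cardsU1 h5 h2; split=> //.
rewrite edge_nbr_cons /cover; apply/subsetP => x /bigcupP[e].
rewrite !inE => /orP[/eqP ->|eE xe].
  by rewrite !inE => /orP[] /eqP ->; rewrite ?uv // (adj_sym G v) uv !orbT.
have := h3 x; rewrite inE => -> //; rewrite ?orbT //.
by apply/bigcupP; exists e.
Qed.

(** The optimum of the subgraph induced by [A]. Deleting vertices only shrinks [A], so vertices are
    never renamed. *)
Definition nu A : nat :=
  \max_(M : {set {set 'I_n}} | induced_matching G M && (cover M \subset A)) #|M|.

Lemma nu_le A M : induced_matching G M -> cover M \subset A -> #|M| <= nu A.
Proof. by move=> h1 h2; apply: (leq_bigmax_cond M); rewrite h1. Qed.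

Lemma nu_leP A k :
  (forall M, induced_matching G M -> cover M \subset A -> #|M| <= k) -> nu A <= k.
Proof. by move=> h; apply/bigmax_leqP => M /andP[]; apply: h. Qed.

Lemma nu_attained A :
  exists2 M, induced_matching G M /\ cover M \subset A & nu A = #|M|.
Proof.
set P := fun M => induced_matching G M && (cover M \subset A).
have P0 : 0 < #|P|.
  by apply/card_gt0P; exists set0; rewrite unfold_in /P induced_set0 /cover big_set0 sub0set.
by have [M /andP[h1 h2] /= E] := eq_bigmax_cond (fun M => #|M|) P0; exists M.
Qed.

Lemma nu_setT : nu setT = max_induced_matching G.
Proof. by apply: eq_bigl => M; rewrite subsetT andbT. Qed.

Lemma nu_mono A B : A \subset B -> nu A <= nu B.
Proof. by move=> AB; apply: nu_leP => M h1 h2; apply/nu_le/(subset_trans h2). Qed.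

Lemma coverP_in A M x : cover M \subset A -> x \in cover M -> x \in A.
Proof. by move=> /subsetP h /h. Qed.

Lemma nu_add A u v : u \in A -> v \in A -> G u v ->
  (nu (A :\: (nbr u :|: nbr v))).+1 <= nu A.
Proof.
move=> uA vA uv.
have [M [h1 +] ->] := nu_attained (A :\: (nbr u :|: nbr v)).
rewrite subsetD => /andP[h2 h3].
have [h4 h5] := induced_add h1 uv h3.
have <- : #|[set u; v] |: M| = #|M|.+1 by rewrite cardsU1 h5.
apply: nu_le => //; apply/subsetP => x /bigcupP[e]; rewrite !inE => /orP[/eqP ->|eM xe].
  by rewrite !inE => /orP[]/eqP ->.
by apply: (coverP_in h2); apply/bigcupP; exists e.
Qed.

(** Picking [uv] destroys at most one edge of [M]: if two edges of [M] met [nbr u :|: nbr v],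
    neither could contain [u] or [v], and each would contain a neighbour of [v] other than [u],
    against the degree of [v]. *)
Lemma nu_pendant A u v : u \in A -> v \in A -> (forall x, x \in A -> G u x = (x == v)) ->
  #|nbr v :&: A| <= 2 ->
  nu A <= (nu (A :\: (nbr u :|: nbr v))).+1.
Proof.
move=> uA vA uP vd; apply: nu_leP => M h1 h2.
have [i1 i2] := induced_matchingP _ h1.
have uv : G u v by rewrite uP ?eqxx.
pose C := [set e in M | ~~ [disjoint e & nbr u :|: nbr v]].
have C1 : #|C| <= 1.
  apply/card_le1_eqP => e f; rewrite !inE => /andP[eM eC] /andP[fM fC].
  have inA g x : g \in M -> x \in g -> x \in A.
    by move=> gM xg; apply: (coverP_in h2); apply/bigcupP; exists g.
  have [//|ef] := eqVneq e f.
  have meet g : g \in M -> ~~ [disjoint g & nbr u :|: nbr v] ->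
      exists2 x, x \in g & (x == v) || G v x.
    move=> gM; rewrite -setI_eq0 => /set0Pn[x]; rewrite !inE => /andP[xg].
    by rewrite uP ?(inA g) // => xuv; exists x.
  have noV g g' : g \in M -> g' \in M -> g != g' -> ~~ [disjoint g' & nbr u :|: nbr v] ->
      v \notin g.
    move=> gM g'M gg' /(meet _ g'M)[x xg' xv]; apply/negP => vg.
    by have [] := i2 g g' gM g'M gg' v x vg xg'; rewrite eq_sym; case/orP: xv => ->.
  have noU g g' : g \in M -> g' \in M -> g != g' -> ~~ [disjoint g' & nbr u :|: nbr v] ->
      u \notin g.
    move=> gM g'M gg' dg'; have vg := noV g g' gM g'M gg' dg'; apply/negP => ug.
    have [x [y [xy gE]]] := i1 g gM.
    have [xA yA] : x \in A /\ y \in A by split; apply: (inA g) => //; rewrite gE !inE eqxx ?orbT.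
    move: ug vg; rewrite gE !inE => /orP[]/eqP uE; subst u.
      by have := uP _ yA; rewrite xy eq_sym (eq_sym v y) => <-; rewrite orbT.
    by have := uP _ xA; rewrite adj_sym xy (eq_sym v x) => <-.
  have fe : f != e by rewrite eq_sym.
  have [x xe xv] := meet _ eM eC; have [y yf yv] := meet _ fM fC.
  have vne := noV e f eM fM ef fC; have une := noU e f eM fM ef fC.
  have vnf := noV f e fM eM fe eC; have unf := noU f e fM eM fe eC.
  have [xy _] := i2 e f eM fM ef x y xe yf.
  have xv' : x != v by apply: contraNneq vne => <-.
  have yv' : y != v by apply: contraNneq vnf => <-.
  have xu' : x != u by apply: contraNneq une => <-.
  have yu' : y != u by apply: contraNneq unf => <-.
  move: xv yv; rewrite (negPf xv') (negPf yv') /= => xv yv.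
  (* [u], [x] and [y] are three distinct neighbours of [v] in [A]. *)
  have : #|[set u; x; y]| <= #|nbr v :&: A|.
    apply/subset_leq_card/subsetP => z; rewrite !inE.
    case/orP=> [/orP[]|] /eqP ->; first by rewrite adj_sym uv uA.
      by rewrite xv (inA e).
    by rewrite yv (inA f).
  rewrite -setUA cardsU1 !inE negb_or !(eq_sym u) xu' yu' cards2 xy => h.
  by have := leq_trans h vd.
have -> : #|M| = #|C| + #|M :\: C|.
  rewrite -(cardsID C M); congr (_ + _).
  by apply: eq_card => e; rewrite !inE; case: (e \in M).
rewrite -add1n leq_add // nu_le //.
  by apply: induced_sub h1; rewrite subsetDl.
apply/subsetP => x /bigcupP[e]; rewrite !inE => /andP[eC eM] xe.
apply/andP; split; last by apply: (coverP_in h2); apply/bigcupP; exists e.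
apply: contra eC => xuv; rewrite eM /= -setI_eq0; apply/set0Pn; exists x.
by rewrite !inE xe.
Qed.

Lemma nu_isolated A u : (forall x, x \in A -> ~~ G u x) -> nu A <= nu (A :\ u).
Proof.
move=> uP; apply: nu_leP => M h1 h2; apply: nu_le => //; apply/subsetP => x xM.
rewrite !inE (coverP_in h2 xM) andbT; apply: contraTneq xM => ->.
apply/negP => /bigcupP[e eM ue]; have [i1 _] := induced_matchingP _ h1.
have [a [b [ab eE]]] := i1 e eM.
have eA y : y \in e -> y \in A.
  by move=> ye; apply: (coverP_in h2); apply/bigcupP; exists e.
move: ue; rewrite eE !inE => /orP[]/eqP uE; subst u.
  by have := uP b (eA b _); rewrite ab eE !inE eqxx orbT => /(_ isT).
by have := uP a (eA a _); rewrite adj_sym ab eE !inE eqxx => /(_ isT).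
Qed.

Lemma nu_edgeless A : (forall x y, x \in A -> y \in A -> ~~ G x y) -> nu A = 0.
Proof.
move=> AP; apply/eqP; rewrite -leqn0; apply: nu_leP => M h1 h2.
rewrite leqn0 cards_eq0 -subset0; apply/subsetP => e eM.
have [i1 _] := induced_matchingP _ h1.
have [a [b [ab eE]]] := i1 e eM.
have eA y : y \in e -> y \in A.
  by move=> ye; apply: (coverP_in h2); apply/bigcupP; exists e.
by have := AP a b (eA a _) (eA b _); rewrite ab eE !inE !eqxx orbT => /(_ isT isT).
Qed.

(* The component of [d] in the subgraph induced by [A] is a path from [d] to [a]. *)
Inductive path_ends : {set 'I_n} -> 'I_n -> 'I_n -> Prop :=
| path_ends_nil A d : d \in A -> (forall x, x \in A -> ~~ G d x) -> path_ends A d d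
| path_ends_cons A d e a : d \in A -> e \in A ->
    (forall x, x \in A -> G d x = (x == e)) -> path_ends (A :\ d) e a ->
    path_ends A d a.

Lemma path_ends_inv A d a : path_ends A d a ->
  (d \in A) /\ ((d = a /\ forall x, x \in A -> ~~ G d x) \/
  exists e, [/\ e \in A, e != d, forall x, x \in A -> G d x = (x == e)
              & path_ends (A :\ d) e a]).
Proof.
case=> {A d a} [A d dA dP|A d e a dA eA dP p]; split=> //; first by left.
right; exists e; split=> //.
by have : G d e; [rewrite dP | apply: contraTneq => ->; rewrite adj_irr].
Qed.

Lemma path_ends_last A d a : path_ends A d a -> a \in A.
Proof. by elim=> {A d a} // A d e a _ _ _ _; rewrite !inE => /andP[]. Qed.

(** * Paths and cycles in graphs of maximum degree at most two *)

Hypothesis deg2 : forall v, #|nbr v| <= 2.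

Lemma deg2_in v A : #|nbr v :&: A| <= 2.
Proof. by apply: leq_trans (deg2 v); rewrite subset_leq_card ?subsetIl. Qed.

(* Picking the first edge of the path is optimal in both graphs, and leaves the
   same situation on a path with three vertices less. *)
Lemma nu_path_ends A d a : path_ends A d a -> nu (A :\ a) <= nu (A :\ d).
Proof.
have [m] := ubnP #|A|; elim: m A d a => // m IH A d a /ltnSE Am.
move=> /path_ends_inv[dA [[-> //]|[e [eA ed dP]]]].
have de : G d e by rewrite dP ?eqxx.
have ede : G e d by rewrite adj_sym.
(* A path of two vertices: once [e] is removed, [d] is isolated. *)
move=> /path_ends_inv[_ [[<- eP]|[f [+ fe eP]]]].
  have {}eP x : x \in A -> x != d -> ~~ G e x by move=> xA xd; apply: eP; rewrite !inE xd.
  apply: leq_trans (nu_mono _); first apply: (@nu_isolated _ d) => x.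
    rewrite !inE => /andP[xe xA]; by rewrite dP.
  by apply/subsetP => x; rewrite !inE => /and3P[-> _ ->].
rewrite !inE => /andP[fd fA].
have {}eP x : x \in A -> x != d -> G e x = (x == f) by move=> xA xd; apply: eP; rewrite !inE xd.
have ef : G e f by rewrite eP ?eqxx.
have fee : G f e by rewrite adj_sym.
have eAd : e \in A :\ d by rewrite !inE ed.
have fAd : f \in A :\ d by rewrite !inE fd.
move=> /path_ends_inv[_ [[fa fP]|[g [+ gf fP pe]]]].
  (* A path of three vertices: [de] is optimal in [A :\ f], and [ef] replaces it in [A :\ d]. *)
  subst a.
  have {}fP x : x \in A -> x != d -> x != e -> ~~ G f x.
    by move=> xA xd xe; apply: fP; rewrite !inE xe xd.
  have dP' x : x \in A :\ f -> G d x = (x == e) by rewrite !inE => /andP[_ xA]; apply: dP.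
  have dAf : d \in A :\ f by rewrite !inE eq_sym fd.
  have eAf : e \in A :\ f by rewrite !inE eq_sym fe.
  apply: leq_trans (nu_pendant dAf eAf dP' (deg2_in _ _)) _.
  apply: leq_trans (nu_add eAd fAd ef); rewrite ltnS; apply: nu_mono.
  apply/subsetP => x; rewrite !inE => /andP[xde /andP[xf xA]].
  have xd : x != d by apply: contraNneq xde => ->; rewrite ede orbT.
  have xe : x != e by apply: contraNneq xde => ->; rewrite de.
  by rewrite (negPf (fP _ xA xd xe)) orbF xA xd; move: xde; rewrite negb_or => /andP[_ ->].
rewrite !inE => /and3P[ge gd gA].
have {}fP x : x \in A -> x != d -> x != e -> G f x = (x == g).
  by move=> xA xd xe; apply: fP; rewrite !inE xe xd.
have := path_ends_last pe; rewrite !inE => /and4P[af ae ad aA].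
have dAa : d \in A :\ a by rewrite !inE eq_sym ad.
have eAa : e \in A :\ a by rewrite !inE eq_sym ae.
have dP' x : x \in A :\ a -> G d x = (x == e) by rewrite !inE => /andP[_ xA]; apply: dP.
(* A longer path: [de] is picked in [A :\ a] and [ef] in [A :\ d]. The remainders are compared by
   induction on the path from [g] to [a], which has lost [a] in the first case and [g] in the
   second. *)
apply: leq_trans (nu_pendant dAa eAa dP' (deg2_in _ _)) _.
apply: leq_trans (nu_add eAd fAd ef); rewrite ltnS.
have /IH/(_ pe) ih : #|A :\ d :\ e :\ f| < m.
  apply: leq_trans Am; apply: proper_card; rewrite properE; apply/andP; split.
    by apply/subsetP => x; rewrite !inE => /and4P[].
  by apply/subsetPn; exists d; rewrite // !inE eqxx !andbF.
apply: leq_trans (leq_trans ih _); apply: nu_mono; apply/subsetP => x; rewrite !inE.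
  move=> /andP[xde /andP[-> ->]]; rewrite andbT /=.
  by apply/and3P; split; apply: contraNneq xde => ->; rewrite ?ef ?de ?ede ?orbT.
move=> /andP[xg /and4P[xf xe xd xA]].
by rewrite eP // fP // (negPf xf) (negPf xg) xd xA.
Qed.

Lemma deg_del A y x : y \in A ->
  #|nbr x :&: (A :\ y)| = #|nbr x :&: A| - G x y.
Proof.
move=> yA; rewrite (cardsD1 y (nbr x :&: A)) !inE yA andbT addKn.
by apply: eq_card => z; rewrite !inE andbCA.
Qed.

Lemma regular_path_ends B x a : x \in B -> a \in B ->
  (if x == a then #|nbr x :&: B| = 0
   else #|nbr x :&: B| = 1 /\ #|nbr a :&: B| = 1) ->
  (forall y, y \in B -> y != x -> y != a -> #|nbr y :&: B| != 1) ->
  path_ends B x a.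
Proof.
have [m] := ubnP #|B|; elim: m B x => // m IH B x /ltnSE Bm xB aB.
case: eqVneq => [<- x0 _|xa [/eqP/cards1P[e xE] a1] oth].
  apply: path_ends_nil => // y yB; apply/negP => xy.
  by have := cards0_eq x0 => /setP/(_ y); rewrite !inE xy yB.
have xP y : y \in B -> G x y = (y == e).
  by move=> yB; have := xE => /setP/(_ y); rewrite !inE yB andbT.
have eB : e \in B by have := xE => /setP/(_ e); rewrite !inE eqxx => /andP[].
have xe : G x e by rewrite xP ?eqxx.
have ex : e != x by apply: contraTneq xe => ->; rewrite adj_irr.
apply: (path_ends_cons xB eB xP); apply: IH.
- by apply: leq_trans Bm; rewrite [X in _ < X](cardsD1 x) xB.
- by rewrite !inE ex.
- by rewrite !inE eq_sym xa.
- rewrite !deg_del // (adj_sym G e) xe; case: eqVneq => [->|ea]; first by rewrite a1.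
  rewrite (adj_sym G a) xP // eq_sym (negPf ea) a1 subn0; split=> //.
  have := oth e eB ex ea; have := deg2_in e B.
  have : 0 < #|nbr e :&: B| by apply/card_gt0P; exists x; rewrite !inE adj_sym xe.
  by case: #|_| => [|[|[|]]].
- move=> y; rewrite !inE => /andP[yx yB] ye ya.
  by rewrite deg_del // (adj_sym G y) xP // (negPf ye) subn0 oth.
Qed.

(* All components are cycles or isolated vertices: a maximum induced matching can
   be rotated along the cycle through [v]. *)
Lemma nu_cycle A v : v \in A -> (forall y, y \in A -> #|nbr y :&: A| != 1) ->
  nu A <= nu (A :\ v).
Proof.
move=> vA reg; apply: nu_leP => M h1 h2.
have [i1 _] := induced_matchingP _ h1.
have eA e y : e \in M -> y \in e -> y \in A.
  by move=> eM ye; apply: (coverP_in h2); apply/bigcupP; exists e.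
have [vM|vM] := boolP (v \in cover M); last first.
  apply: nu_le => //; apply/subsetP => x xM; rewrite !inE (coverP_in h2 xM) andbT.
  by apply: contraNneq vM => <-.
have /bigcupP[e eM ve] := vM.
have [b vb eE] : exists2 b, G v b & e = [set v; b].
  have [x [y [xy eE]]] := i1 e eM.
  move: ve; rewrite eE !inE => /orP[]/eqP ->; first by exists y.
  by exists x; rewrite 1?adj_sym // setUC.
have bA : b \in A by apply: (eA e); rewrite // eE !inE eqxx orbT.
have bv : G b v by rewrite adj_sym.
have bnv : b != v by apply: contraTneq vb => ->; rewrite adj_irr.
(* The edges of [M] other than [vb] avoid the neighbourhoods of [v] and [b]. *)
apply: (@leq_trans (nu (A :\: (nbr v :|: nbr b))).+1).
  rewrite (cardsD1 e) eM add1n ltnS; apply: nu_le.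
    by apply: induced_sub h1; rewrite subsetDl.
  apply/subsetP => x /bigcupP[f]; rewrite !inE => /andP[fe fM] xf.
  rewrite (eA f) // andbT negb_or; have [_ i2] := induced_matchingP _ h1.
  have ef : e != f by rewrite eq_sym.
  have [] := i2 e f eM fM ef v x ve xf.
  by have [|_ -> _ ->] := i2 e f eM fM ef b x _ xf; rewrite // eE !inE eqxx orbT.
have deg_v : #|nbr v :&: A| = 2.
  have := reg v vA; have := deg2_in v A.
  have : 0 < #|nbr v :&: A| by apply/card_gt0P; exists b; rewrite !inE vb.
  by case: #|_| => [|[|[|]]].
have /cards2P[a0 [b0 [ab0 vE]]] : #|nbr v :&: A| == 2 by rewrite deg_v.
have [a ab vP] : exists2 a, a != b & forall x, x \in A -> G v x = (x == a) || (x == b).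
  have := vE => /setP/(_ b); rewrite !inE vb bA => /esym/orP[]/eqP bE; subst b.
    exists b0; first by rewrite eq_sym.
    by move=> x xA; have := vE => /setP/(_ x); rewrite !inE xA andbT orbC.
  by exists a0 => // x xA; have := vE => /setP/(_ x); rewrite !inE xA andbT.
have [aA va] : a \in A /\ G v a.
  have : a \in nbr v :&: A.
    have := deg_v; rewrite (cardsD1 a); case: (a \in nbr v :&: A) => //.
    rewrite add0n => h2'; have : nbr v :&: A :\ a \subset [set b].
      by apply/subsetP => x; rewrite !inE => /and3P[xa + xA]; rewrite vP // (negPf xa).
    by move/subset_leq_card; rewrite h2' cards1.
  by rewrite !inE => /andP[].
have av : G a v by rewrite adj_sym.
have anv : a != v by apply: contraTneq va => ->; rewrite adj_irr.
have deg_o y : y \in A -> G v y -> #|nbr y :&: A| = 2.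
  move=> yA vy; have := reg y yA; have := deg2_in y A.
  have : 0 < #|nbr y :&: A| by apply/card_gt0P; exists v; rewrite !inE adj_sym vy.
  by case: #|_| => [|[|[|]]].
(* Without [v], its cycle becomes a path between its two neighbours [b] and [a]. *)
have : path_ends (A :\ v) b a.
  apply: regular_path_ends; rewrite ?inE ?anv ?bnv //.
    by rewrite eq_sym (negPf ab) !deg_del // !deg_o // av bv.
  move=> y; rewrite !inE => /andP[yv yA] yb ya.
  by rewrite deg_del // adj_sym vP // (negPf ya) (negPf yb) subn0 reg.
move=> /path_ends_inv[_ [[ba _]|[c [+ cb bP]]]]; first by rewrite ba eqxx in ab.
rewrite !inE => /andP[cv cA].
have {}bP x : x \in A -> x != v -> G b x = (x == c).
  by move=> xA xv; apply: bP; rewrite !inE xv.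
have bc : G b c by rewrite bP ?eqxx.
have cbv : c \in A :\ v by rewrite !inE cv.
have bAv : b \in A :\ v by rewrite !inE bnv.
(* The edge [vb] is exchanged for [bc], where [c] follows [b] on the path. If [c = a], the cycle is
   a triangle. *)
move=> /path_ends_inv[_ [[ca cP]|[d [dA' dc cP pe]]]]; apply: leq_trans (nu_add bAv cbv bc);
  rewrite ltnS.
  apply: nu_mono; apply/subsetP => x; rewrite !inE negb_or => /andP[/andP[xv xb] xA].
  have xnb : x != b by apply: contraNneq xv => ->.
  have xnv : x != v by apply: contraNneq xb => ->.
  by rewrite xnv xA (negPf xb) cP // !inE xnb xnv.
(* Of the path from [d] to [a], the choice of [vb] removes [a] and the choice of [bc] removes
   [d]. *)
have nu1 := nu_path_ends pe.
move: dA'; rewrite !inE => /and3P[db dv dA].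
apply: leq_trans (leq_trans nu1 _); apply: nu_mono; apply/subsetP => x; rewrite !inE.
  rewrite negb_or => /andP[/andP[xv xb] ->]; rewrite andbT.
  apply/and4P; split; [move: xv|move: xb|move: xv|move: xb]; by apply: contraNneq => ->.
move=> /andP[xd /and4P[xc xb xv xA]].
by rewrite bP // cP ?inE ?xb ?xv // (negPf xc) (negPf xd).
Qed.

End Graph.

(** * Coded search *)

Section Search.

Variables (n : nat) (G : sgraph n).
Implicit Types (E : seq ('I_n * 'I_n)) (X : {set 'I_n}) (M : {set {set 'I_n}}).

(* A configuration consists of a number (of neighbours to be skipped, or coding
   the remaining choices), the edges picked, and the blocked vertices. *)
Definition config := (nat * seq ('I_n * 'I_n) * {set 'I_n})%type.

(** Picking an edge blocks [v] itself, so the rest of the scan picks nothing more. When no skips are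
    left, blocked neighbours are passed over until a free one is found. *)
Definition match_step (v : 'I_n) (c : config) (w : 'I_n) : config :=
  let: (j, E, X) := c in
  if G v w then
    if j is j'.+1 then (j', E, X)
    else if (v \in X) || (w \in X) then c
    else (0, (v, w) :: E, nbr G v :|: nbr G w :|: X)
  else c.

Definition match_loop (v : 'I_n) (c : config) : config :=
  foldl (match_step v) c (rev (enum 'I_n)).

(* The lowest bit of [m] tells whether [v] is to be matched, and the next
   base-[D] digit to which neighbour. *)
Definition sim_step (D : nat) (c : config) (v : 'I_n) : config :=
  let: (m, E, X) := c in
  if v \in X then c
  else if odd m then
    let c' := match_loop v (m./2 %% D, E, X) in (m./2 %/ D, c'.1.2, c'.2)
  else (m./2, E, X).

Lemma rotate_subproof (p : nat) (i : 'I_n) : (i + p) %% n < n.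
Proof. by rewrite ltn_mod (leq_ltn_trans (leq0n i)). Qed.

Definition rotate (p : nat) (i : 'I_n) : 'I_n := Ordinal (rotate_subproof p i).

(** Descending, as loop counters are: from [p - 1] modulo [n] round to [p]. *)
Definition cyclic_order (p : nat) : seq 'I_n := [seq rotate p i | i <- rev (enum 'I_n)].

Definition sim (D p m : nat) : config :=
  foldl (sim_step D) (m, [::], set0) (cyclic_order p).

(** Only an inclusion, because the greedy algorithm also blocks the vertices that it deletes. *)
Definition valid E X := imatching G E && (edge_nbr G E \subset X).

Lemma match_stop v j E X L : v \in X ->
  let c := foldl (match_step v) (j, E, X) L in c.1.2 = E /\ c.2 = X.
Proof.
move=> vX; elim: L j => [//|w L IH] j /=.
by case: (G v w) => //; case: j => [|j'] //; rewrite vX /=.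
Qed.

Lemma match_loop_valid v j E X : v \notin X ->
  let c := match_loop v (j, E, X) in
  (c.1.2 = E /\ c.2 = X) \/
  exists w, [/\ G v w, w \notin X, c.1.2 = (v, w) :: E
              & c.2 = nbr G v :|: nbr G w :|: X].
Proof.
move=> vX /=; rewrite /match_loop.
elim: (rev _) j => [|w L IH] j /=; first by left.
case: ifP => vw; last exact: IH.
case: j => [|j]; last exact: IH.
rewrite (negPf vX) /=; case: ifP => [_|wX]; first exact: IH.
right; exists w; rewrite wX.
have [|-> ->] // := @match_stop v 0 ((v, w) :: E) (nbr G v :|: nbr G w :|: X) L.
by rewrite !inE adj_sym vw orbT.
Qed.

Lemma match_loop_found v u E X : v \notin X -> G v u -> u \notin X ->
  exists w, [/\ G v w, w \notin X, (match_loop v (0, E, X)).1.2 = (v, w) :: E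
              & (match_loop v (0, E, X)).2 = nbr G v :|: nbr G w :|: X].
Proof.
move=> vX vu uX; rewrite /match_loop.
have : u \in rev (enum 'I_n) by rewrite mem_rev mem_enum.
elim: (rev _) => //= w L IH; rewrite inE => uL.
have [vw|vw] := boolP (G v w); last first.
  by apply: IH; case/predU1P: uL => // uw; rewrite -uw vu in vw.
rewrite (negPf vX) /=; have [wX|wX] := boolP (w \in X).
  by apply: IH; case/predU1P: uL => // uw; rewrite uw wX in uX.
exists w; have [|-> ->] // := @match_stop v 0 ((v, w) :: E) (nbr G v :|: nbr G w :|: X) L.
by rewrite !inE adj_sym vw orbT.
Qed.

Lemma valid_cons v w E X : valid E X -> G v w -> v \notin X -> w \notin X ->
  valid ((v, w) :: E) (nbr G v :|: nbr G w :|: X).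
Proof.
move=> /andP[h1 h2] vw vX wX; rewrite /valid edge_nbr_cons setUS //= vw h1.
by rewrite !(contra (subsetP h2 _)).
Qed.

Lemma card_cover M : induced_matching G M -> #|cover M| = 2 * #|M|.
Proof.
move=> MI.
have [i1 _] := induced_matchingP _ _ MI.
have /andP[/andP[_ /eqP <-] _] := MI.
have -> : \sum_(e in M) #|e| = \sum_(e in M) 2.
  apply: eq_bigr => e eM; have [x [y [xy ->]]] := i1 e eM; rewrite cards2.
  by have -> : x != y by apply: contraTneq xy => ->; rewrite adj_irr.
by rewrite sum_nat_const mulnC.
Qed.

Lemma valid_size E X : valid E X -> size E <= n.
Proof.
move=> /andP[/imatching_induced[MI <- _] _].
have := card_cover MI; have : #|cover (edge_set E)| <= n.
  by rewrite -[X in _ <= X](card_ord n) max_card.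
lia.
Qed.

(** The number of neighbours of [v] scanned before [u], which is the digit that codes the choice of
    [u]. *)
Definition rank (v u : 'I_n) : nat :=
  count (G v) (take (index u (rev (enum 'I_n))) (rev (enum 'I_n))).

Lemma count_enum_ord (P : pred 'I_n) (A : {set 'I_n}) : P =1 [in A] ->
  count P (enum 'I_n) = #|A|.
Proof.
by move=> PA; rewrite -sum1_count -sum1_card big_enum_cond; apply: eq_bigl => i; rewrite PA.
Qed.

Lemma rank_lt v u : G v u -> rank v u < #|nbr G v|.
Proof.
move=> vu; rewrite /rank; set L := rev _.
have -> : #|nbr G v| = count (G v) L.
  by rewrite count_rev; apply/esym/count_enum_ord => x; rewrite /= inE.
have uL : u \in L by rewrite mem_rev mem_enum.
rewrite -[in X in _ < X](cat_take_drop (index u L) L) count_cat.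
rewrite (drop_nth u) ?index_mem // nth_index //= vu; lia.
Qed.

Lemma match_loop_rank v u E X : G v u -> v \notin X -> u \notin X ->
  match_loop v (rank v u, E, X) = (0, (v, u) :: E, nbr G v :|: nbr G u :|: X).
Proof.
move=> vu vX uX; rewrite /match_loop /rank; set L := rev _.
have uL : u \in L by rewrite mem_rev mem_enum.
rewrite -[X in foldl _ _ X](cat_take_drop (index u L) L) foldl_cat.
have -> L1 : foldl (match_step v) (count (G v) L1, E, X) L1 = (0, E, X).
  by elim: L1 => //= w L1 IH; case: (G v w).
rewrite (drop_nth u) ?index_mem // nth_index //= vu (negPf vX) (negPf uX) /=.
set X' := _ :|: _; have : v \in X' by rewrite !inE adj_sym vu orbT.
move: X' => X' vX'; elim: (drop _ _) => //= w L1 IH.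
by case: (G v w) => //; rewrite vX'.
Qed.

(** The code 0 leaves every remaining vertex unmatched, so it suffices to code the choices on an
    initial segment. *)
Lemma sim0 D L E X : foldl (sim_step D) (0, E, X) L = (0, E, X).
Proof. by elim: L => //= v L IH; case: ifP. Qed.

(** * Codes for the choices made along a fixed matching *)

Section Follow.

Variable M : {set {set 'I_n}}.
Hypothesis MI : induced_matching G M.

Definition mate (v : 'I_n) : option 'I_n := [pick u | G v u && ([set v; u] \in M)].

Definition follow_step E (v : 'I_n) :=
  if v \in edge_nbr G E then E else if mate v is Some u then (v, u) :: E else E.

Definition inM E := forall p, p \in E -> G p.1 p.2 /\ [set p.1; p.2] \in M.

Lemma inM_follow E L : inM E -> inM (foldl follow_step E L).
Proof.
elim: L E => //= v L IH E EM; apply: IH; rewrite /follow_step /mate.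
case: ifP => // _; case: pickP => // u /andP[vu uM] p.
by rewrite inE => /orP[/eqP -> //|]; apply: EM.
Qed.

Lemma mate_cover v : v \in cover M -> exists2 u, G v u & [set v; u] \in M.
Proof.
have [i1 _] := induced_matchingP _ _ MI.
move=> /bigcupP[e eM ve]; have [x [y [xy eE]]] := i1 e eM.
move: ve eM; rewrite eE !inE => /orP[]/eqP -> eM; first by exists y.
by exists x; [rewrite adj_sym | rewrite setUC].
Qed.

Lemma mateN v : mate v = None -> v \notin cover M.
Proof.
rewrite /mate; case: pickP => // h _; apply/negP => /mate_cover[u vu uM].
by have := h u; rewrite vu uM.
Qed.

Lemma edge_nbr_cover E v : inM E -> v \in edge_nbr G E -> v \in cover M ->
  exists2 p, p \in E & v \in [set p.1; p.2].
Proof.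
move=> EM; rewrite inE => /hasP[p pE pv] vM; exists p => //.
have [p12 pM] := EM p pE; case/orP: pv => pv.
  have /= -> := induced_adj MI pM _ pv vM; rewrite !inE eqxx ?orbT //.
have /= -> := induced_adj MI pM _ pv vM; by rewrite !inE eqxx ?orbT.
Qed.

(** A vertex covered by [M] can be dominated by edges of [M] only as an endpoint of one of them,
    together with its mate. Hence the mate of a free vertex is free. *)
Lemma edge_nbr_mate E v u : inM E -> G v u -> [set v; u] \in M ->
  u \in edge_nbr G E -> v \in edge_nbr G E.
Proof.
move=> EM vu uM uE.
have uc : u \in cover M by apply/bigcupP; exists [set v; u]; rewrite // !inE eqxx orbT.
have vc : v \in cover M by apply/bigcupP; exists [set v; u]; rewrite // !inE eqxx.
have [p pE up] := edge_nbr_cover EM uE uc; have [p12 pM] := EM p pE.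
rewrite inE; apply/hasP; exists p => //.
have uv : G u v by rewrite adj_sym.
have := induced_adj MI pM up uv vc => /setP/(_ v); rewrite !inE eqxx orbT.
by case/orP=> /eqP ->; [rewrite (adj_sym G p.2) p12 orbT | rewrite p12].
Qed.

Definition uncovered L := count (fun v => v \notin cover M) L.

(** The code is built from the end of [L], starting with the residual code [m]: an unmatched free
    vertex turns [k] into [2 * k], a matched one into [1 + 2 * (rank v u + D * k)], and a dominated
    one leaves [k] alone. The bound grows by factors 2 and [2 * D] accordingly. *)
Lemma sim_follow D L E m : (forall v, #|nbr G v| <= D) -> inM E ->
  exists h k,
    [/\ size (foldl follow_step E L) = size E + h,
        k < m.+1 * (2 ^ (uncovered L + h) * D ^ h)
      & foldl (sim_step D) (k, E, edge_nbr G E) L =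
        (m, foldl follow_step E L, edge_nbr G (foldl follow_step E L))].
Proof.
move=> deg; elim: L E => [|v L IH] E EM /=.
  by exists 0, m; rewrite addn0 muln1.
have EM1 := @inM_follow _ [:: v] EM; rewrite /= in EM1.
have [h [k [hs hk he]]] := IH _ EM1.
have [vE|vE] := boolP (v \in edge_nbr G E).
  have sE : follow_step E v = E by rewrite /follow_step vE.
  rewrite sE in hs he *; exists h, k; split=> //.
  apply: leq_trans hk _; rewrite leq_mul2l leq_mul2r leq_exp2l //.
  by rewrite leq_add2r leq_addl !orbT.
case Ev : (mate v) => [u|]; last first.
  have sE : follow_step E v = E by rewrite /follow_step Ev if_same.
  rewrite sE in hs he *; exists h, (2 * k); split=> //.
    by rewrite (mateN Ev) add1n addSn expnS; nia.
  by rewrite mul2n odd_double doubleK.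
have sE : follow_step E v = (v, u) :: E by rewrite /follow_step (negPf vE) Ev.
rewrite sE in hs he *.
move: Ev; rewrite /mate; case: pickP => // u' /andP[vu uM] [uu]; subst u'.
have uE : u \notin edge_nbr G E by apply: contra vE; apply: edge_nbr_mate vu uM.
have rD : rank v u < D by apply: leq_trans (deg v); apply: rank_lt.
exists h.+1, (1 + 2 * (rank v u + D * k)); split.
- by rewrite hs /= addSnnS.
- have -> : v \in cover M by apply/bigcupP; exists [set v; u]; rewrite // !inE eqxx.
  rewrite add0n addnS !expnS.
  move: hk; set B := 2 ^ _; set C := D ^ _ => hk.
  have -> : m.+1 * (2 * B * (D * C)) = 2 * (D * (m.+1 * (B * C))) by lia.
  nia.
rewrite mul2n /= odd_double /= uphalf_double.
have D0 : 0 < D by case: (D) rD.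
have -> : (rank v u + D * k) %% D = rank v u by rewrite mulnC addnC modnMDl modn_small.
rewrite match_loop_rank //= -[nbr G v :|: _ :|: _](edge_nbr_cons G (v, u)).
have -> : (rank v u + D * k) %/ D = k.
  by rewrite mulnC addnC divnMDl // divn_small // addn0.
exact: he.
Qed.

(** When [v] is reached, either its edge is picked or [v] is already dominated, and then it is an
    endpoint by inducedness. *)
Lemma follow_cover E L v : inM E -> v \in L -> v \in cover M ->
  exists2 p, p \in foldl follow_step E L & v \in [set p.1; p.2].
Proof.
elim: L E => //= x L IH E EM; rewrite inE => /orP[/eqP <- {x}|vL] vM; last first.
  by apply: IH => //; apply: (@inM_follow _ [:: x]).
have [p pE vp] : exists2 p, p \in follow_step E v & v \in [set p.1; p.2].
  rewrite /follow_step; case: ifP => [vE|_]; first exact: edge_nbr_cover.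
  case Ev : (mate v) => [u|]; last by rewrite (negPf (mateN Ev)) in vM.
  by exists (v, u); rewrite !inE eqxx.
exists p => //; elim: L (follow_step E v) pE {IH} => //= x L IH E' pE'; apply: IH.
rewrite /follow_step; case: ifP => // _; case: (mate x) => // u.
by rewrite inE pE' orbT.
Qed.

Lemma count_follow L : uniq L ->
  count [in cover M] L <= 2 * size (foldl follow_step [::] L).
Proof.
move=> uL; set E := foldl _ _ _; rewrite -size_filter.
pose ends := flatten [seq [:: p.1; p.2] | p <- E].
have -> : 2 * size E = size ends.
  by rewrite /ends; elim: (E) => //= p E' /= <-; lia.
apply: uniq_leq_size; first exact: filter_uniq.
move=> v; rewrite mem_filter => /andP[vM vL].
have [//|p pE vp] := @follow_cover [::] L v _ vL vM.
apply/flattenP; exists [:: p.1; p.2]; first by apply/mapP; exists p.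
by move: vp; rewrite !inE.
Qed.

End Follow.

(** As the order is descending, its initial segments are the windows that end just before [p + n],
    taken modulo [n]. *)
Lemma count_cyclic_order (S : {set 'I_n}) p w : w <= n ->
  count [in S] (take w (cyclic_order p)) =
  count (fun j => [exists v in S, v == j %% n :> nat]) (iota (p + n - w) w).
Proof.
move=> wn; pose f j := [exists v in S, v == j %% n :> nat].
rewrite -[X in _ = count X _]/f.
have fE i : rotate p i \in S = f (i + p).
  apply/idP/existsP => [iS|[v /andP[vS /eqP vi]]].
    by exists (rotate p i); rewrite iS /=.
  by have -> : rotate p i = v by apply: val_inj.
rewrite /cyclic_order -map_take count_map.
rewrite (eq_count (a2 := (fun j => f (j + p)) \o val)); last by move=> i; rewrite /= fE.
rewrite -count_map map_take map_rev val_enum_ord take_rev count_rev size_iota.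
rewrite drop_iota add0n subKn //.
have -> : p + n - w = p + (n - w) by lia.
rewrite iotaDl count_map; apply: eq_count => j /=; congr f; lia.
Qed.

(* The cycle lemma: start where the excess of [S] over its average is maximal. *)
Lemma cyclic_density (S : {set 'I_n}) : 0 < n ->
  exists2 p, p < n & forall w, w <= n ->
    w * #|S| <= n * count [in S] (take w (cyclic_order p)).
Proof.
move=> n0; pose f j := [exists v in S, v == j %% n :> nat].
pose c m := count f (iota 0 m).
have cn : c n = #|S|.
  rewrite /c -val_enum_ord count_map; apply: count_enum_ord => v /=; apply/existsP/idP => [[u /andP[uS]]|vS].
    by rewrite modn_small // => /eqP/val_inj <-.
  by exists v; rewrite vS modn_small /=.
have cD m l : c (m + l) = c m + count f (iota m l).
  by rewrite /c iotaD count_cat add0n.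
have cper m : c (m + n) = c m + #|S|.
  rewrite addnC cD cn addnC; congr (_ + _).
  rewrite -{1}(addn0 n) iotaDl count_map; apply: eq_count => j /=.
  by apply: eq_existsb => v; rewrite modnDl.
(* The excess [n * c m - #|S| * m], shifted by [n * #|S|] to remain a natural number. Every window
   ending at a maximum of it is at least as dense as the average. *)
pose g (m : 'I_n) := n * c m + #|S| * (n - m).
have [p _ pmax] := @arg_maxnP _ (Ordinal n0) xpredT g isT.
exists p => // w wn; rewrite count_cyclic_order // -/f.
have := cD (p + n - w) w; rewrite subnK; last by lia.
rewrite cper => E.
have pn := ltn_ord p; have Sn : #|S| <= n by rewrite -[X in _ <= X]card_ord max_card.
(* If [w <= p], the window is a translate by [n] of one that starts at [p - w]; otherwise it wraps
   round 0. *)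
case: (leqP n (p + n - w)) => q.
  have qn : p - w < n by lia.
  have := pmax (Ordinal qn) isT; rewrite /g /=.
  have := cper (p - w); have -> : p - w + n = p + n - w by lia.
  move=> E2; have -> : c p = c (p - w) + count f (iota (p + n - w) w) by lia.
  have -> : n - (p - w) = n - p + w by lia.
  by rewrite !mulnDr; lia.
have := pmax (Ordinal q) isT; rewrite /g /=.
have -> : n - (p + n - w) = w - p by lia.
have := congr1 (muln n) E; rewrite !mulnDr.
have : #|S| * (n - p) + #|S| * p = n * #|S| by rewrite -mulnDr subnK 1?mulnC // ltnW.
have : #|S| * (w - p) + #|S| * p = w * #|S| by rewrite -mulnDr subnK 1?mulnC //; lia.
move: (n * c p) (n * c _) (n * count _ _) (#|S| * (w - p)) (#|S| * (n - p)) (#|S| * p)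
  (n * #|S|) (w * #|S|); lia.
Qed.

Lemma cyclic_order_uniq p : uniq (cyclic_order p).
Proof.
rewrite map_inj_uniq ?rev_uniq ?enum_uniq // => i j /(congr1 val) /= /eqP.
by rewrite eqn_modDr !modn_small // => /eqP/val_inj.
Qed.

Lemma size_cyclic_order p : size (cyclic_order p) = n.
Proof. by rewrite size_map size_rev size_enum_ord. Qed.

Lemma sim_approx a b D : (forall v, #|nbr G v| <= D) -> 1 < D -> 0 < n ->
  0 < b -> b <= a ->
  exists p m, [/\ p < n, m < (2 * D) ^ ((b * n %/ a + 3) %/ 2)
    & b * max_induced_matching G <= a * size (sim D p m).1.2].
Proof.
move=> deg D1 n0 b0 ba.
rewrite -nu_setT; have [M [MI _] ->] := nu_attained G setT.
have [k0|k0] := posnP #|M|.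
  by exists 0, 0; rewrite k0 muln0 n0 expn_gt0 muln_gt0 (ltnW D1).
have [p pn dens] := cyclic_density (cover M) n0.
pose E w := foldl (follow_step M) [::] (take w (cyclic_order p)).
have uL w : uniq (take w (cyclic_order p)) by rewrite take_uniq ?cyclic_order_uniq.
have k2n : 2 * #|M| <= n.
  by rewrite -(card_cover MI) -[X in _ <= X](card_ord n) max_card.
(* The whole order picks all of [M]. *)
have ex : exists w, b * #|M| <= a * size (E w).
  exists n; have := count_follow MI (uL n); have := dens n (leqnn n).
  rewrite (card_cover MI) -/(E n) leq_pmul2l // => h1 h2.
  by apply: leq_mul => //; lia.
(* The run is cut as soon as the required size is reached. *)
case: (ex_minnP ex) => -[|w] hw wmin.
  by move: hw; rewrite /E take0 /= muln0 leqn0 muln_eq0 !eqn0Ngt b0 k0.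
have wn : w < n.
  rewrite ltnNge; apply/negP => nw; have : w.+1 <= w; last by rewrite ltnn.
  apply: wmin; move: hw; rewrite /E !take_oversize // size_cyclic_order // (leq_trans nw) //.
have hw' : a * size (E w) < b * #|M|.
  by rewrite ltnNge; apply/negP => /wmin; rewrite ltnn.
have inM0 : inM M [::] by [].
have [h [m [hs hm he]]] := sim_follow MI (take w.+1 (cyclic_order p)) 0 deg inM0.
exists p, m; split=> //; last first.
  rewrite /sim -(cat_take_drop w.+1 (cyclic_order p)) foldl_cat.
  have <- : edge_nbr G [::] = set0 by apply/setP => x; rewrite !inE.
  by rewrite he sim0.
apply: leq_trans hm _; rewrite mul1n.
pose v := nth (Ordinal n0) (cyclic_order p) w.
have tE : take w.+1 (cyclic_order p) = rcons (take w (cyclic_order p)) v.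
  by rewrite (take_nth (Ordinal n0)) // size_cyclic_order.
(* By minimality, the last vertex before the cut picks an edge, so it is covered. *)
have [hE vM] : h = (size (E w)).+1 /\ v \in cover M.
  move: hs hw; rewrite /E tE foldl_rcons -/(E w) {1 2}/follow_step.
  case: ifP => [_ _|_]; first by rewrite leqNgt hw'.
  rewrite /mate; case: pickP => [u /andP[_ uM] /= -> _|_ _]; last by rewrite leqNgt hw'.
  by split=> //; apply/bigcupP; exists [set v; u]; rewrite // !inE eqxx.
have zE : uncovered M (take w.+1 (cyclic_order p)) = uncovered M (take w (cyclic_order p)).
  by rewrite tE /uncovered -cats1 count_cat /= vM !addn0.
rewrite zE.
have := count_predC [in cover M] (take w (cyclic_order p)).
rewrite size_take size_cyclic_order wn.
have -> : count (predC [in cover M]) (take w (cyclic_order p)) =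
          uncovered M (take w (cyclic_order p)) by [].
have := dens w (ltnW wn); have := count_follow MI (uL w).
rewrite -/(E w) (card_cover MI).
move: (count _ _) (uncovered _ _) => c z h1 h2 h3.
(* Let [s] be [size (E w)] and [k] be [#|M|]. The density bound [2k(c + z) <= nc] gives
   [2kz <= (n - 2k)c], and [c <= 2s] then yields the claim. *)
have kz : #|M| * (z + 2 * size (E w)) <= n * size (E w).
  move: (size (E w)) h1 h2 k2n => s cs; rewrite -h3; move: #|M| => k dens' kn.
  have [d nE] : exists d, n = d + 2 * k by exists (n - 2 * k); rewrite subnK.
  have := leq_mul (leqnn d) cs; move: dens'; rewrite nE; clear; nia.
have az : a * (z + 2 * size (E w)) <= b * n.
  rewrite -(leq_pmul2l k0).
  have : a * (#|M| * (z + 2 * size (E w))) <= a * (n * size (E w)) by rewrite leq_mul2l kz orbT.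
  have : n * (a * size (E w)) <= n * (b * #|M|) by rewrite leq_mul2l ltnW ?orbT.
  nia.
have a0 : 0 < a by lia.
have zdiv : z + 2 * size (E w) <= b * n %/ a by rewrite leq_divRL // mulnC.
(* One more edge is picked at the cut, so twice the number of edges plus [z] is at most
   [b * n %/ a + 2]; the constant 3 also pays for rounding [z] up to an even number. *)
rewrite hE; set e := (_ + 3) %/ 2; set h' := (size (E w)).+1.
have he' : uphalf z + h' <= e by rewrite /e /h'; lia.
apply: leq_trans (_ : (2 * D) ^ (uphalf z + h') <= _); last first.
  by rewrite leq_pexp2l // muln_gt0 (ltnW D1).
rewrite !expnD (expnMn 2 D h') mulnA leq_mul2r leq_mul2r; apply/orP; right.
(* Two binary choices cost a factor 4, which is at most [2 * D] because [1 < D]. *)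
apply/orP; right; apply: (@leq_trans (2 ^ (2 * uphalf z))).
  by rewrite leq_exp2l //; lia.
by rewrite expnM; case: (uphalf z) => // y; rewrite leq_exp2r //; lia.
Qed.

End Search.

(** * The programs *)

(* Arrays: 2 output; 3 blocked vertices; 4, 9, 10, 13, 14, 19 loop counters;
   5 current vertex; 6 coded choices; 7 neighbours to skip; 8 size of the output;
   11 maximum degree; 12 degree; 15, 16 best size and its code; 17, 23 kind and
   name of the selected vertex; 18 starting point; 20 current code;
   21, 22 numbers of choices. *)
Definition Put (a : nat) (e : expr) : prog := Assign a (Lit 0) e.

Definition adj_expr (v w : expr) : expr :=
  Cell 1 (Bin Add (Bin Mul v (Var 0)) w).

Definition mod_expr (e1 e2 : expr) : expr :=
  Bin Defs.Sub e1 (Bin Mul (Bin Div e1 e2) e2).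

Definition add_edge_prog : prog :=
  Seq (Assign 2 (Bin Add (Bin Mul (Var 5) (Var 0)) (Var 4)) (Lit 1))
 (Seq (Put 8 (Bin Add (Var 8) (Lit 1)))
      (For 9 (Var 0)
         (If (Bin Add (adj_expr (Var 5) (Var 9)) (adj_expr (Var 4) (Var 9)))
             (Assign 3 (Var 9) (Lit 1)) Skip))).

Definition match_prog : prog :=
  For 4 (Var 0)
    (If (adj_expr (Var 5) (Var 4))
       (If (Var 7) (Put 7 (Bin Defs.Sub (Var 7) (Lit 1)))
          (If (Bin Add (Cell 3 (Var 5)) (Cell 3 (Var 4))) Skip add_edge_prog))
       Skip).

(** The code in variable 20 packs the starting point, its remainder modulo [n], with the choices,
    its quotient. *)
Definition sim_prog : prog :=
  Seq (For 19 (Bin Mul (Var 0) (Var 0))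
         (Seq (Assign 2 (Var 19) (Lit 0)) (Assign 3 (Var 19) (Lit 0))))
 (Seq (Put 8 (Lit 0))
 (Seq (Put 18 (mod_expr (Var 20) (Var 0)))
 (Seq (Put 6 (Bin Div (Var 20) (Var 0)))
      (For 10 (Var 0)
         (Seq (Put 5 (mod_expr (Bin Add (Var 10) (Var 18)) (Var 0)))
              (If (Cell 3 (Var 5)) Skip
                 (Seq (Put 7 (mod_expr (Var 6) (Lit 2)))
                 (Seq (Put 6 (Bin Div (Var 6) (Lit 2)))
                      (If (Var 7)
                         (Seq (Put 7 (mod_expr (Var 6) (Var 11)))
                         (Seq (Put 6 (Bin Div (Var 6) (Var 11))) match_prog))
                         Skip))))))))).

Definition deg_prog : prog :=
  Seq (Put 12 (Lit 0))
      (For 4 (Var 0)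
         (If (adj_expr (Var 5) (Var 4))
            (If (Cell 3 (Var 4)) Skip (Put 12 (Bin Add (Var 12) (Lit 1)))) Skip)).

Definition maxdeg_prog : prog :=
  Seq (Put 11 (Lit 0))
      (For 10 (Var 0)
         (Seq (Put 5 (Var 10))
         (Seq deg_prog
              (If (Bin Defs.Sub (Var 12) (Var 11)) (Put 11 (Var 12)) Skip)))).

(** A vertex of degree 1 overrides every other candidate; otherwise the first vertex met of degree
    at least 2 is kept. *)
Definition select_prog : prog :=
  Seq (Put 17 (Lit 0))
      (For 10 (Var 0)
         (If (Cell 3 (Var 10)) Skip
            (Seq (Put 5 (Var 10))
            (Seq deg_prog
                 (If (Var 12)
                    (If (Bin Defs.Sub (Var 12) (Lit 1))
                       (If (Var 17) Skip (Seq (Put 17 (Lit 1)) (Put 23 (Var 10))))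
                       (Seq (Put 17 (Lit 2)) (Put 23 (Var 10))))
                    Skip))))).

(** A vertex of kind 2 is matched to its only free neighbour, and one of kind 1 is deleted by
    blocking it. Either action uses up a free vertex, so [n] rounds suffice. *)
Definition greedy_prog : prog :=
  For 14 (Var 0)
    (Seq select_prog
    (Seq (Put 5 (Var 23))
         (If (Var 17)
            (If (Bin Defs.Sub (Var 17) (Lit 1)) (Seq (Put 7 (Lit 0)) match_prog)
               (Assign 3 (Var 5) (Lit 1)))
            Skip))).

(** Only the best code is remembered; running it once more restores its matching. *)
Definition search_prog (a b : nat) : prog :=
  Seq (Put 21 (Lit 1))
 (Seq (For 13 (Bin Div (Bin Add (Bin Div (Bin Mul (Lit b) (Var 0)) (Lit a)) (Lit 3)) (Lit 2))
         (Put 21 (Bin Mul (Var 21) (Bin Mul (Lit 2) (Var 11)))))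
 (Seq (Put 22 (Bin Mul (Var 21) (Var 0)))
 (Seq (Put 15 (Lit 0))
 (Seq (Put 16 (Lit 0))
 (Seq (For 14 (Var 22)
         (Seq (Put 20 (Var 14))
         (Seq sim_prog
              (If (Bin Defs.Sub (Var 8) (Var 15))
                 (Seq (Put 15 (Var 8)) (Put 16 (Var 20))) Skip))))
 (Seq (Put 20 (Var 16)) sim_prog)))))).

Definition approx_prog (a b : nat) : prog :=
  Seq maxdeg_prog
      (If (Bin Defs.Sub (Var 11) (Lit 2)) (search_prog a b) greedy_prog).

Lemma triple_assign_seq W T1 T2 T s a i e c (Q : state -> Prop) :
  1 < W -> bounded W s -> max_lit i <= W -> max_lit e <= W -> eval s e <= W ->
  ecost i + ecost e + vsize i + vsize e <= T1 ->
  (bounded W (update s a (eval s i) (eval s e)) ->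
   triple W c T2 (update s a (eval s i) (eval s e)) Q) ->
  T1 + T2 <= T -> triple W (Seq (Assign a i e) c) T s Q.
Proof.
move=> W1 Ws li le eW h1 h2 hT.
apply: (@triple_seq _ _ _ T1 T2 _ _ (fun s1 => s1 = update s a (eval s i) (eval s e))) => //.
  exact: triple_assign.
by move=> s1 b1 _ s1E; rewrite s1E in b1 *; apply: h2.
Qed.

Lemma foldl_map (A B C : Type) (f : A -> B) (g : C -> B -> C) c s :
  foldl g c (map f s) = foldl (fun c a => g c (f a)) c s.
Proof. by elim: s c => //= a s IH c. Qed.

(** * Correctness and running time of the simulation *)

Section Subroutines.

Variables (n : nat) (G : sgraph n) (W : nat).
Hypotheses (W3 : 3 < W) (nW : n * n < W) (n1W : n < W).
Implicit Types (E : seq ('I_n * 'I_n)) (X : {set 'I_n}).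

Let W1 : 1 < W. Proof. by lia. Qed.

Definition ctx (s : state) :=
  s 0 0 = n /\ forall u v : 'I_n, s 1 (u * n + v) = G u v.

Lemma ctx_frame l s s1 : frame l s s1 -> 0 \notin l -> 1 \notin l -> ctx s -> ctx s1.
Proof. by move=> f l0 l1; rewrite /ctx !f. Qed.

Definition blocks X (s : state) := forall v : 'I_n, (s 3 v != 0) = (v \in X).

Definition stores E X (s : state) :=
  [/\ forall u v : 'I_n, (s 2 (u * n + v) != 0) = ((u, v) \in E),
      s 8 0 = size E, blocks X s & valid G E X].

Lemma cell_inj (u v u' v' : 'I_n) : u * n + v = u' * n + v' -> (u, v) = (u', v').
Proof.
move=> h; have n0 : 0 < n by apply: leq_ltn_trans (ltn_ord u).
have hu : u = u'.
  have := congr1 (divn^~ n) h; rewrite !divnMDl // !divn_small // !addn0.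
  exact: val_inj.
by subst u'; move/addnI: h => /val_inj ->.
Qed.

Lemma triple_add_edge s E X (v w : 'I_n) :
  bounded W s -> ctx s -> s 5 0 = v -> s 4 0 = w -> stores E X s ->
  G v w -> v \notin X -> w \notin X ->
  triple W add_edge_prog (60 * n + 50) s
    (stores ((v, w) :: E) (nbr G v :|: nbr G w :|: X)).
Proof.
move=> Ws [s0 s1] s5 s4 [st1 st2 st3 st4] vw vX wX.
have val := valid_cons st4 vw vX wX.
have size_n := valid_size val; rewrite /= in size_n.
apply: (@triple_assign_seq _ 19 (60 * n + 30)) => //=; try lia.
rewrite s5 s4 s0 => b1.
apply: (@triple_assign_seq _ 10 (60 * n + 20)) => //=; try lia.
  by rewrite /update /= st2; lia.
rewrite [update _ 2 _ _ 8 0]st2 => b2; set s' := update _ _ _ _.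
(* The loop runs downwards, so the vertices from [i] on have been treated. *)
pose I i (s2 : state) := forall u : 'I_n,
  (s2 3 u != 0) = (u \in X) || (i <= u) && (G v u || G w u).
apply: (@triple_conseq _ _ (n * (46 + 14) + 3 + 1 + 6) _ _ (I 0)); [|lia|].
  apply: (@triple_for W 9 (Var 0) _ 46 _ n I) => //=; first lia.
    move=> u.
    by rewrite (st3 u : (update s' 9 0 n 3 u != 0) = _) leqNgt ltn_ord orbF.
  move=> i s2 im bs2 f2 Is2; pose x := Ordinal im.
  have e5 : update s2 9 0 i 5 0 = v by rewrite /update /= f2.
  have e4 : update s2 9 0 i 4 0 = w by rewrite /update /= f2.
  have e0 : update s2 9 0 i 0 0 = n by rewrite /update /= f2.
  have e1 (y : 'I_n) : update s2 9 0 i 1 (y * n + i) = G y x.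
    by rewrite /update /= f2 //; apply: (s1 y x).
  have bu : bounded W (update s2 9 0 i) by apply: bounded_update => //; lia.
  have upd_i (u : 'I_n) : (i <= u) = (u == x) || (i.+1 <= u).
    by rewrite leq_eqVlt eq_sym -val_eqE.
  apply: (@triple_if _ _ _ _ 6) => //.
  - rewrite [eval _ _]/= e5 e4 e0 !e1 => ne.
    apply: triple_assign => //=; try lia.
    move=> u; rewrite /update /=; case: (eqVneq (u : nat) i) => ui.
      have -> : u = x by apply: val_inj.
      by rewrite [i <= x]leqnn; case: (G v x) (G w x) ne => [] [] //= _; rewrite orbT.
    have /negPf ux : u != x by rewrite -val_eqE.
    by rewrite upd_i ux; apply: Is2.
  rewrite [eval _ _]/= e5 e4 e0 !e1 => ne.
  apply: triple_skip => // u; have := Is2 u; rewrite upd_i /update /= => ->.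
  case: eqVneq => [->|//]; rewrite ltnn /=.
  by case: (G v x) (G w x) ne => [] [].
move=> s2 bs2 f2 Is2; split=> //.
- move=> u u'; rewrite f2 // /s' /update /= inE.
  have -> : (u * n + u' == v * n + w) = ((u, u') == (v, w)).
    by apply/eqP/eqP => [/cell_inj|[-> ->]].
  by case: ((u, u') == (v, w)) => //=; apply: st1.
- by rewrite f2 // /s' /update /= addn1.
- by move=> u; rewrite Is2 !inE orbC.
Qed.

Lemma triple_match s E X (v : 'I_n) :
  bounded W s -> ctx s -> s 5 0 = v -> stores E X s ->
  triple W match_prog (n * (60 * n + 120) + 10) s
    (fun s1 => let c := match_loop G v (s 7 0, E, X) in stores c.1.2 c.2 s1).
Proof.
move=> Ws cs s5 st.
pose R (c : config n) (s1 : state) := s1 7 0 = c.1.1 /\ stores c.1.2 c.2 s1.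
apply: (@triple_conseq _ _ (n * (60 * n + 106 + 14) + 10) _ _
  (R (match_loop G v (s 7 0, E, X)))); [|lia|by move=> s1 _ _ []].
apply: (@triple_for_fold n W 4 (Var 0) _ (60 * n + 106)) => //=; try lia; try (by case: cs); try (by split).
move=> w [[j E1] X1] s1 b1 f1 [/= s7 st1].
have [c0 c1] : ctx (update s1 4 0 w) by apply: (ctx_frame f1).
have e5 : update s1 4 0 w 5 0 = v by rewrite /update /= f1.
have bu : bounded W (update s1 4 0 w).
  by apply: bounded_update => //; have := ltn_ord w; lia.
have stu : stores E1 X1 (update s1 4 0 w) by [].
have e7 : update s1 4 0 w 7 0 = j by [].
have e4 : update s1 4 0 w 4 0 = w by [].
move: {s1 b1 f1 s7 st1} (update s1 4 0 w) => s1 in c0 c1 e5 bu stu e7 e4 *.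
apply: (@triple_if _ _ _ _ (60 * n + 80)) => //=; [| |lia]; rewrite e5 c0 e4 c1.
  rewrite eqb0 negbK => vw; rewrite vw.
  apply: (@triple_if _ _ _ _ (60 * n + 74)) => //=; [| |lia]; rewrite e7.
    case: j e7 => // j e7 _; apply: triple_assign => //=; try lia.
      by apply: leq_trans (leq_subr _ _) (bu _ _).
    by rewrite e7 subn1.
  move=> j0; rewrite j0; rewrite j0 in e7; have [_ _ bl _] := stu.
  apply: (@triple_if _ _ _ _ (60 * n + 50)) => //=; [| |lia]; rewrite e5 e4.
    rewrite addn_eq0 negb_and !bl => -> /=.
    by apply: triple_skip => //; lia.
  move/eqP; rewrite addn_eq0 -[_ && _]negbK negb_and !bl => /negPf vwX; rewrite vwX.
  move: vwX => /negbT; rewrite negb_or => /andP[vX wX].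
  apply: triple_conseq (triple_add_edge bu (conj c0 c1) e5 e4 stu vw vX wX) (leqnn _) _.
  by move=> s2 b2 f2 st2; split=> //=; rewrite f2.
move/eqP; rewrite eqb0 => /negPf ->.
by apply: triple_skip => //; lia.
Qed.

Lemma eval_mod s e1 e2 : eval s (mod_expr e1 e2) = eval s e1 %% eval s e2.
Proof. by rewrite /= {1}(divn_eq (eval s e1) (eval s e2)) addKn. Qed.

Lemma triple_sim s (D : nat) :
  bounded W s -> ctx s -> s 11 0 = D -> (n > 0) ->
  triple W sim_prog (n * n * 30 + n * (n * (60 * n + 120) + 200) + 100) s
    (fun s1 => let c := sim G D (s 20 0 %% n) (s 20 0 %/ n) in stores c.1.2 c.2 s1).
Proof.
move=> Ws cs s11 n0; have [c0 _] := cs.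
pose I i (s2 : state) := forall k, i <= k < n * n -> s2 2 k = 0 /\ s2 3 k = 0.
apply: (@triple_seq _ _ _ (n * n * 30 + 20) (n * (n * (60 * n + 120) + 200) + 80)
  _ _ (I 0)); last by lia.
  apply: (@triple_for W 19 _ _ 16 _ (n * n) I) => //=; [by rewrite c0|lia| | |lia].
    by move=> k; lia.
  move=> i s1 im b1 f1 I1.
  have bu : bounded W (update s1 19 0 i) by apply: bounded_update => //; lia.
  apply: (@triple_assign_seq _ 8 8) => //= b2.
  apply: triple_assign => //= k ik; rewrite /update /=.
  by case: eqVneq => // ki; apply: I1; lia.
move=> s1 b1 f1 I1.
have cs1 : ctx s1 by apply: (ctx_frame f1).
have [c1 _] := cs1.
apply: (@triple_assign_seq _ 10 (n * (n * (60 * n + 120) + 200) + 70)) => //=; [|lia].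
move=> b2.
apply: (@triple_assign_seq _ 30 (n * (n * (60 * n + 120) + 200) + 40)) => //.
- rewrite eval_mod /=; apply: leq_trans (leq_mod _ _) _; exact: b2.
- rewrite eval_mod => b3.
  apply: (@triple_assign_seq _ 20 (n * (n * (60 * n + 120) + 200) + 20)) => //.
  + by rewrite /=; apply: leq_trans (leq_div _ _) _; apply: b3.
  + move=> b4; set s2 := update _ 6 _ _; have {}b4 : bounded W s2 by [].
    have s2p : s2 18 0 = s 20 0 %% n by rewrite /s2 /update /= c1 f1.
    have s2m : s2 6 0 = s 20 0 %/ n by rewrite /s2 /update /= c1 f1.
    have cs2 : ctx s2 by [].
    have s2D : s2 11 0 = D by rewrite /s2 /update /= f1.
    have s20 : stores [::] set0 s2.
      split=> //.
      * move=> u v; have := ltn_ord u; have := ltn_ord v => vn un.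
        by have [] := I1 (u * n + v); [nia|rewrite /s2 /update /= => -> _; rewrite in_nil].
      * move=> v; have [] := I1 v; first by have := ltn_ord v; nia.
        by rewrite /s2 /update /= => _ ->; rewrite inE.
      * by apply/subsetP => x; rewrite inE.
    move: s2 b4 s2p s2m cs2 s2D s20 => s2 b4 s2p s2m cs2 s2D s20.
    pose p := s 20 0 %% n.
    pose R (c : config n) (s3 : state) := s3 6 0 = c.1.1 /\ stores c.1.2 c.2 s3.
    apply: (@triple_conseq _ _ (n * (n * (60 * n + 120) + 186 + 14) + 10) _ _
      (R (sim G D p (s 20 0 %/ n)))); [|lia|by move=> s3 _ _ []].
    rewrite /sim /cyclic_order foldl_map.
    apply: (@triple_for_fold n W 10 (Var 0) _ (n * (60 * n + 120) + 186)) => //=;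
      try lia; try (by case: cs2); try (by split).
    move=> i [[m E] X] s3 b3' f3 [/= s3m st3].
    have cs3 : ctx s3 by apply: (ctx_frame f3).
    have [c3 _] := cs3.
    have s3p : s3 18 0 = p by rewrite f3.
    have s3D : s3 11 0 = D by rewrite f3.
    have bu : bounded W (update s3 10 0 i).
      by apply: bounded_update => //; have := ltn_ord i; lia.
    have ev5 : eval (update s3 10 0 i) (mod_expr (Bin Add (Var 10) (Var 18)) (Var 0)) =
        rotate p i by rewrite eval_mod /update /= s3p c3.
    apply: (@triple_assign_seq _ 50 (n * (60 * n + 120) + 136)) => //; try (by rewrite /=; lia).
      by rewrite ev5; have := ltn_ord (rotate p i); lia.
    rewrite ev5 [eval _ _]/=.
    move: (rotate p i) => v b5 {ev5}.
    have st4 : stores E X (update (update s3 10 0 i) 5 0 v) by [].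
    have cs4 : ctx (update (update s3 10 0 i) 5 0 v) by [].
    have s4v : update (update s3 10 0 i) 5 0 v 5 0 = v by [].
    have s4m : update (update s3 10 0 i) 5 0 v 6 0 = m by [].
    have s4D : update (update s3 10 0 i) 5 0 v 11 0 = D by [].
    move: (update (update s3 10 0 i) 5 0 v) b5 st4 cs4 s4v s4m s4D
      => s4 b5 st4 cs4 s4v s4m s4D {bu}.
    have [_ _ bl _] := st4.
    apply: (@triple_if _ _ _ _ (n * (60 * n + 120) + 130)) => //=; try lia; rewrite s4v.
      by rewrite bl => ->; apply: triple_skip => //; lia.
    move/eqP; rewrite -[_ == _]negbK bl => /negPf vX; rewrite vX.
    apply: (@triple_assign_seq _ 25 (n * (60 * n + 120) + 105)) => //=; try lia.
    have -> : s4 6 0 - s4 6 0 %/ 2 * 2 = odd m.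
      by rewrite s4m {1}(divn_eq m 2) addKn modn2.
    move=> b6; apply: (@triple_assign_seq _ 10 (n * (60 * n + 120) + 95)) => //=; try lia.
      by apply: leq_trans (leq_div _ _) (b6 _ _).
    rewrite [update s4 7 _ _ 6 0]s4m divn2 => b7.
    apply: (@triple_if _ _ _ _ (n * (60 * n + 120) + 91)) => //=; try lia.
      rewrite [update _ _ _ _ _ _]/= eqb0 negbK => mo; rewrite mo /= in b7 *.
      apply: (@triple_assign_seq _ 30 (n * (60 * n + 120) + 60)) => //.
+ by rewrite eval_mod; apply: leq_trans (leq_mod _ _) (b7 _ _).
      + rewrite eval_mod => b8.
        apply: (@triple_assign_seq _ 15 (n * (60 * n + 120) + 45)) => //.
        * by rewrite /=; apply: leq_trans (leq_div _ _) (b8 _ _).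
        * move=> b9; set s5 := update _ 6 _ _.
          have s5m : s5 6 0 = m./2 %/ D by rewrite /s5 /update /= s4D.
          have s5j : s5 7 0 = m./2 %% D by rewrite /s5 /update /= s4D.
          have st5 : stores E X s5 by [].
          have cs5 : ctx s5 by [].
          have := @triple_match s5 E X v b9 cs5 s4v st5; rewrite s5j => tr.
          apply: triple_conseq tr _ _; first by lia.
          by move=> s6 b6' f6 st6; split=> //=; rewrite f6.
        * by rewrite /=; lia.
      + by rewrite /=; lia.
    rewrite [update _ _ _ _ _ _]/= => /eqP; rewrite eqb0 => /negPf mo; rewrite mo in b7 *.
    by apply: triple_skip => //; lia.
  + by rewrite /=; lia.
- by rewrite /=; lia.
Qed.

End Subroutines.

(** * Degrees, the greedy algorithm and the exhaustive search *)

Section Algorithms.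

Variables (n : nat) (G : sgraph n) (W : nat).
Hypotheses (W3 : 3 < W) (nW : n * n < W) (n1W : n < W).
Implicit Types (E : seq ('I_n * 'I_n)) (X S : {set 'I_n}).

Let W1 : 1 < W. Proof. by lia. Qed.

(** The elements of [S] already visited when a descending counter has reached [i]. *)
Definition tail S (i : nat) : {set 'I_n} := [set w in S | i <= w].

Lemma card_tail S i (im : i < n) :
  #|tail S i| = (Ordinal im \in S) + #|tail S i.+1|.
Proof.
rewrite (cardsD1 (Ordinal im)) inE leqnn andbT; congr (_ + _).
apply: eq_card => w; rewrite !inE -val_eqE /= ltn_neqAle eq_sym.
by case: (w \in S); rewrite ?andbF.
Qed.

Lemma triple_deg s X (v : 'I_n) :
  bounded W s -> ctx G s -> s 5 0 = v -> blocks X s ->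
  triple W deg_prog (50 * n + 20) s (fun s1 => s1 12 0 = #|nbr G v :&: ~: X|).
Proof.
move=> Ws cs s5 bl; set S := _ :&: _.
apply: (@triple_assign_seq _ 4 (50 * n + 16)) => //=; try lia; move=> b0.
set s0 := update _ _ _ _.
pose I i (s1 : state) := s1 12 0 = #|tail S i|.
apply: (@triple_conseq _ _ (n * (35 + 14) + 10) _ _ (I 0)); [|lia|]; last first.
  by move=> s1 _ _ ->; apply: eq_card => w; rewrite inE andbT.
apply: (@triple_for W 4 (Var 0) _ 35 _ n I) => //=; try lia.
- by case: cs.
- rewrite /I eq_card0 // => w; rewrite inE; have := ltn_ord w.
  by rewrite ltnNge => /negPf ->; rewrite andbF.
move=> i s1 im b1 f1 I1.
have [c0 c1] : ctx G (update s1 4 0 i) by apply: (ctx_frame f1).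
have e5 : update s1 4 0 i 5 0 = v by rewrite /update /= f1.
have e4 : update s1 4 0 i 4 0 = i by [].
have e12 : update s1 4 0 i 12 0 = #|tail S i.+1| by [].
have e3 : blocks X (update s1 4 0 i).
  by move=> u; rewrite -bl /update /= f1.
have bu : bounded W (update s1 4 0 i) by apply: bounded_update => //; lia.
move: (update s1 4 0 i) c0 c1 e5 e4 e12 e3 bu => s2 c0 c1 e5 e4 e12 e3 bu {s1 b1 f1 I1}.
pose x := Ordinal im; have cx := c1 v x; have bx := e3 x; rewrite /= in cx bx.
have tS : #|tail S i| = (x \in S) + #|tail S i.+1| by apply: card_tail.
have tn : #|tail S i| <= n by rewrite -[X in _ <= X](card_ord n) max_card.
apply: (@triple_if _ _ _ _ 16) => //=; rewrite e5 c0 e4 cx.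
  rewrite eqb0 negbK => vx.
  apply: (@triple_if _ _ _ _ 10) => //=; rewrite e4.
    rewrite bx => xX; apply: triple_skip => //.
    by rewrite /I e12 tS !inE xX andbF.
  move/eqP; rewrite -[_ == _]negbK bx => xX.
  have xS : x \in S by rewrite !inE vx xX.
  rewrite xS in tS.
  apply: triple_assign => //=; try lia.
  by rewrite /I [LHS]/update /= e12 tS addnC.
move/eqP; rewrite eqb0 => vx; apply: triple_skip => //.
by rewrite /I e12 tS !inE (negPf vx).
Qed.

Lemma triple_maxdeg s :
  bounded W s -> ctx G s -> blocks (set0 : {set 'I_n}) s ->
  triple W maxdeg_prog (n * (50 * n + 60) + 20) s (fun s1 => s1 11 0 = maxdeg G).
Proof.
move=> Ws cs bl.
apply: (@triple_assign_seq _ 4 (n * (50 * n + 60) + 16)) => //=; try lia; move=> b0.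
set s0 := update _ _ _ _.
pose I i (s1 : state) := s1 11 0 <= maxdeg G /\
  forall v : 'I_n, i <= v -> #|nbr G v| <= s1 11 0.
apply: (@triple_conseq _ _ (n * (50 * n + 42 + 14) + 10) _ _ (I 0)); [|lia|]; last first.
  move=> s1 _ _ [h1 h2]; apply/eqP; rewrite eqn_leq h1 /=.
  by apply/bigmax_leqP => v _; apply: h2.
apply: (@triple_for W 10 (Var 0) _ (50 * n + 42) _ n I) => //=; try lia.
- by case: cs.
- split=> // v; have := ltn_ord v; lia.
move=> i s1 im b1 f1 [I1 I2].
have bu : bounded W (update s1 10 0 i) by apply: bounded_update => //; lia.
apply: (@triple_assign_seq _ 6 (50 * n + 36)) => //=; try lia.
rewrite [update _ 10 _ _ _ _]/= => b2; set s2 := update _ 5 _ _.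
have cs2 : ctx G s2 by apply: (ctx_frame f1).
have bl2 : blocks (set0 : {set 'I_n}) s2 by move=> u; rewrite -bl /s2 /update /= f1.
have := @triple_deg s2 set0 (Ordinal im) b2 cs2 erefl bl2.
rewrite setC0 setIT => tr.
apply: (triple_seq tr); last by apply: (leq_trans (_ : _ <= 50 * n + 20 + 16)); [|lia].
move=> s3 b3 f3 d3.
have e11 : s3 11 0 = s1 11 0 by rewrite f3.
apply: (@triple_if _ _ _ _ 6) => //=; rewrite d3 e11 => c.
  apply: triple_assign => //=; try lia.
  rewrite /I /update /= d3; split.
    by apply: (leq_bigmax (F := fun v => #|[set u | G v u]|) (Ordinal im)).
  move=> v; rewrite leq_eqVlt => /predU1P[iv|/I2 h]; last first.
    by rewrite subn_eq0 -ltnNge in c; apply: leq_trans h (ltnW c).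
  by have -> : v = Ordinal im by apply: val_inj.
apply: triple_skip => //; rewrite /I e11; split=> // v.
rewrite leq_eqVlt => /predU1P[iv|/I2 //].
have -> : v = Ordinal im by apply: val_inj.
by rewrite -subn_eq0 c.
Qed.

(* [P] holds of the vertices examined so far. *)
Definition selected (P : pred 'I_n) X (s : state) :=
  [\/ s 17 0 = 0 /\ (forall u, P u -> u \notin X -> #|nbr G u :&: ~: X| = 0),
      s 17 0 = 1 /\ (exists v : 'I_n, [/\ v \notin X, s 23 0 = v, 0 < #|nbr G v :&: ~: X|
        & forall u, P u -> u \notin X -> #|nbr G u :&: ~: X| != 1])
    | s 17 0 = 2 /\ (exists v : 'I_n, [/\ v \notin X, s 23 0 = v
        & #|nbr G v :&: ~: X| = 1])].

Lemma triple_select s X :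
  bounded W s -> ctx G s -> blocks X s ->
  triple W select_prog (n * (50 * n + 80) + 20) s (selected predT X).
Proof.
move=> Ws cs bl.
apply: (@triple_assign_seq _ 4 (n * (50 * n + 80) + 16)) => //=; try lia; move=> b0.
set s0 := update _ _ _ _.
pose I i (s1 : state) := selected (fun u => i <= u) X s1.
apply: (@triple_conseq _ _ (n * (50 * n + 58 + 14) + 10) _ _ (I 0)); [|lia|by []].
apply: (@triple_for W 10 (Var 0) _ (50 * n + 58) _ n I) => //=; try lia.
- by case: cs.
- by apply: Or31; split=> // v; have := ltn_ord v; lia.
move=> i s1 im b1 f1 I1; pose x := Ordinal im.
have split_i (u : 'I_n) : i <= u -> u = x \/ i < u.
  by rewrite leq_eqVlt => /predU1P[iu|]; [left; apply: val_inj|right].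
have bu : bounded W (update s1 10 0 i) by apply: bounded_update => //; lia.
have e3 : blocks X (update s1 10 0 i) by move=> u; rewrite -bl /update /= f1.
apply: (@triple_if _ _ _ _ (50 * n + 52)) => //=; try lia; rewrite [update _ 10 _ _ 10 _]/=.
  rewrite (e3 x) => xX; apply: triple_skip; [by []|lia|].
  case: I1 => [[k h]|[k [v [vX sv dv h]]]|h]; [apply: Or31|apply: Or32|by apply: Or33].
    by split=> // u /split_i[-> |/h //]; rewrite xX.
  by split=> //; exists v; split=> // u /split_i[-> |/h //]; rewrite xX.
move/eqP; rewrite -[_ == _]negbK (e3 x) => xX.
apply: (@triple_assign_seq _ 6 (50 * n + 46)) => //=; try lia.
rewrite [update _ 10 _ _ _ _]/= => b2; set s2 := update _ 5 _ _.
have cs2 : ctx G s2 by apply: (ctx_frame f1).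
apply: (triple_seq (@triple_deg s2 X x b2 cs2 erefl e3)); last first.
  by apply: (leq_trans (_ : _ <= 50 * n + 20 + 26)); [|lia].
move=> s3 b3 f3 d3.
have e17 : s3 17 0 = s1 17 0 by rewrite f3.
have e23 : s3 23 0 = s1 23 0 by rewrite f3.
have e10 : s3 10 0 = x by rewrite f3.
apply: (@triple_if _ _ _ _ 22) => //=; rewrite d3 => dx; last first.
  apply: triple_skip => //.
  case: I1 => [[k h]|[k [v [vX sv dv h]]]|[k [v [vX sv dv]]]].
  - by apply: Or31; rewrite e17; split=> // u /split_i[-> |/h //].
  - apply: Or32; rewrite e17 e23; split=> //; exists v; split=> // u /split_i[-> |/h //].
    by rewrite dx.
  - by apply: Or33; rewrite e17 e23; split=> //; exists v.
apply: (@triple_if _ _ _ _ 14) => //=; try lia; rewrite d3 => dx1; last first.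
  apply: (@triple_assign_seq _ 4 6) => //=; try lia; move=> b4.
  apply: triple_assign => //=.
  by apply: Or33; split=> //; exists x; split=> //; lia.
apply: (@triple_if _ _ _ _ 10) => //=; rewrite e17 => k17.
  apply: triple_skip => //.
  case: I1 => [[k h]|[k [v [vX sv dv h]]]|[k [v [vX sv dv]]]].
  - by rewrite k in k17.
  - apply: Or32; rewrite e17 e23; split=> //; exists v; split=> // u /split_i[-> _|/h //].
    by lia.
  - by apply: Or33; rewrite e17 e23; split=> //; exists v.
apply: (@triple_assign_seq _ 4 6) => //=; try lia; move=> b4.
apply: triple_assign => //=.
apply: Or32; split=> //; exists x; split=> //; first by lia.
case: I1 => [[k h]|[k _]|[k _]]; rewrite k in k17 => //.
by move=> u /split_i[-> _|iu /(h u iu) -> //]; lia.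
Qed.

Lemma triple_greedy s :
  (forall v, #|nbr G v| <= 2) ->
  bounded W s -> ctx G s -> stores G [::] set0 s ->
  triple W greedy_prog (n * (n * (110 * n + 200) + 80) + 10) s
    (fun s1 => exists E X, stores G E X s1 /\ max_induced_matching G <= size E).
Proof.
move=> deg Ws cs st.
(* Picked edges plus the optimum on the free vertices never fall below the optimum of [G]. With [i]
   rounds left there are at most [i] free vertices, unless no two free vertices are adjacent. *)
pose J i (s1 : state) := exists E X, [/\ stores G E X s1,
  max_induced_matching G <= size E + nu G (~: X)
  & #|~: X| <= i \/ forall u, u \notin X -> #|nbr G u :&: ~: X| = 0].
apply: (@triple_conseq _ _ (n * (n * (110 * n + 200) + 60 + 14) + 10) _ _ (J 0)); [|lia|];
  last first.
  move=> s1 _ _ [E [X [st1 h1 h2]]]; exists E, X; split=> //.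
  rewrite (nu_edgeless (A := ~: X)) ?addn0 // in h1 => x y.
  rewrite !inE => xX yX; case: h2 => h2.
    have X0 : ~: X = set0 by apply/eqP; rewrite -cards_eq0 -leqn0.
    by have : x \in ~: X; [rewrite inE | rewrite X0 inE].
  have := cards0_eq (h2 x xX) => /setP/(_ y); rewrite !inE yX andbT.
  by move=> ->.
apply: (@triple_for W 14 (Var 0) _ (n * (110 * n + 200) + 60) _ n J) => //=; try lia.
- by case: cs.
- exists [::], set0; split=> //; first by rewrite setC0 nu_setT.
  by left; rewrite -[X in _ <= X](card_ord n) max_card.
move=> i s1 im b1 f1 [E [X [st1 h1 h2]]].
have bu : bounded W (update s1 14 0 i) by apply: bounded_update => //; lia.
have cs1 : ctx G (update s1 14 0 i) by apply: (ctx_frame f1).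
have stu : stores G E X (update s1 14 0 i) by [].
have [_ _ bl val] := stu.
apply: (triple_seq (triple_select bu cs1 bl)
  (T2 := n * (60 * n + 120) + 40)); last by lia.
move=> s2 b2 f2 sel.
have cs2 : ctx G s2 by apply: (ctx_frame f2).
have st2 : stores G E X s2 by rewrite /stores /blocks !f2.
move=> {s1 b1 f1 st1 bu cs1 stu bl f2}.
apply: (@triple_assign_seq _ 6 (n * (60 * n + 120) + 34)) => //=; try lia; move=> b3.
set s3 := update _ _ _ _.
have cs3 : ctx G s3 by []. have st3 : stores G E X s3 by [].
have e17 : s3 17 0 = s2 17 0 by [].
have nbrC v u : (u \in nbr G v :&: ~: X) = G v u && (u \notin X) by rewrite !inE.
apply: (@triple_if _ _ _ _ (n * (60 * n + 120) + 30)) => //=; try lia;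
  rewrite e17 => k; last first.
  apply: triple_skip => //; first lia.
  exists E, X; split=> //; right.
  by case: sel => [[_ h]|[k' _]|[k' _]]; [move=> u; apply: h|rewrite k' in k|rewrite k' in k].
have small : (exists2 v, v \notin X & 0 < #|nbr G v :&: ~: X|) -> #|~: X| <= i.+1.
  by move=> [v vX dv]; case: h2 => // /(_ v vX) d0; rewrite d0 in dv.
apply: (@triple_if _ _ _ _ (n * (60 * n + 120) + 20)) => //=; try lia;
  rewrite e17 => k1.
  case: sel => [[k' _]|[k' _]|[_ [v [vX sv dv]]]]; [by rewrite k' in k|by rewrite k' in k1|].
  have v5 : s3 5 0 = v by rewrite -sv.
  apply: (@triple_assign_seq _ 4 (n * (60 * n + 120) + 10)) => //=; try lia; move=> b4.
  set s4 := update _ 7 _ _.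
  have {}b4 : bounded W s4 by []. have cs4 : ctx G s4 by []. have st4 : stores G E X s4 by [].
  apply: triple_conseq (triple_match W3 nW n1W b4 cs4 v5 st4) _ _; first by lia.
  move=> s5 b5 f5; have s47 : s4 7 0 = 0 by []. rewrite s47 /=.
  have /eqP/cards1P[u uE] := dv.
  have /andP[vu uX] : G v u && (u \notin X) by rewrite -nbrC uE inE.
  have [w [vw wX -> ->]] := match_loop_found E vX vu uX.
  set X' := nbr G v :|: nbr G w :|: X => st5.
  have wu : w = u by apply/set1P; rewrite -uE nbrC vw wX.
  have cX : ~: X :\: (nbr G v :|: nbr G w) = ~: X'.
    by apply/setP => x; rewrite !inE !negb_or.
  exists ((v, w) :: E), X'; split=> //.
    apply: leq_trans h1 _; rewrite /= addSnnS leq_add2l -cX.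
    (* Kind 2: the picked edge is pendant in the free subgraph. *)
    apply: nu_pendant; rewrite ?inE //; last by apply: deg2_in.
    move=> x; rewrite inE => xX; have := uE => /setP/(_ x); rewrite nbrC xX andbT inE => ->.
    by rewrite wu.
  left; rewrite -ltnS; apply: leq_trans (small _); last by exists v; rewrite ?dv.
  apply: proper_card; rewrite properE; apply/andP; split.
    by apply/subsetP => x; rewrite !inE !negb_or => /andP[].
  by apply/subsetPn; exists v; rewrite !inE // (adj_sym G w) vw orbT.
case: sel => [[k' _]|[_ [v [vX sv dv reg]]]|[k' _]]; [by rewrite k' in k| |by rewrite k' in k1].
have v5 : s3 5 0 = v by rewrite -sv.
apply: triple_assign => //=; try lia.
rewrite v5; exists E, (v |: X).
have cX : ~: X :\ v = ~: (v |: X) by apply/setP => x; rewrite !inE negb_or.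
split.
- have [q1 q2 q3 /andP[q4 q5]] := st3; split=> //.
    move=> u; rewrite /update /= !inE -val_eqE /=.
    by case: (nat_of_ord u == v).
  by rewrite /valid q4 (subset_trans q5) // subsetUr.
(* Kind 1: no free vertex has degree 1, so [v] can be deleted. *)
- apply: leq_trans h1 _; rewrite leq_add2l -cX; apply: nu_cycle; rewrite ?inE //.
  by move=> y; rewrite inE => yX; apply: reg.
left; rewrite -cX -ltnS; apply: leq_trans (small _); last by exists v.
by rewrite [X in _ <= X](cardsD1 v) inE vX.
Qed.

Definition sim_time := n * n * 30 + n * (n * (60 * n + 120) + 200) + 100.

Lemma triple_search a b s :
  let D := maxdeg G in let e := (b * n %/ a + 3) %/ 2 in
  let K := (2 * D) ^ e * n in
  a <= W -> b <= W -> e <= W -> K <= W -> 0 < b -> b <= a -> 1 < D ->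
  bounded W s -> ctx G s -> s 11 0 = D ->
  triple W (search_prog a b) (31 * e + (K + 1) * (sim_time + 54) + 80) s
    (fun s1 => exists E X, stores G E X s1 /\
       b * max_induced_matching G <= a * size E).
Proof.
move=> D e K aW bW eW KW b0 ba D1 Ws cs s11.
have n0 : 0 < n.
  rewrite lt0n; apply/eqP => n0; move: D1; rewrite /D /maxdeg big1 // => v.
  by have := ltn_ord v; rewrite {2}n0.
have deg v : #|nbr G v| <= D by apply: (leq_bigmax (F := fun v => #|[set u | G v u]|)).
pose P0 := (2 * D) ^ e.
have PW : P0 <= W by apply: leq_trans KW; rewrite leq_pmulr.
apply: (@triple_assign_seq _ 4 (31 * e + (K + 1) * (sim_time + 54) + 76)) => //=; try lia.
move=> b1; set s1 := update _ _ _ _.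
have cs1 : ctx G s1 by []. have s1D : s1 11 0 = D by [].
pose I i (s2 : state) := i <= e /\ s2 21 0 = (2 * D) ^ (e - i).
apply: (@triple_seq _ _ _ (31 * e + 32) ((K + 1) * (sim_time + 54) + 44) _ _ (I 0));
  last by lia.
  apply: (@triple_for W 13 _ _ 17 _ e I) => //=; try lia.
  - by case: cs1 => ->.
  - by split=> //; rewrite subnn.
  move=> i s2 ie b2 f2 [_ I2].
  have bu : bounded W (update s2 13 0 i) by apply: bounded_update => //; lia.
  have nx : update s2 13 0 i 21 0 * (2 * update s2 13 0 i 11 0) = (2 * D) ^ (e - i).
    rewrite [update _ _ _ _ 21 0]I2 /update /= f2 // s1D.
    by rewrite mulnC -expnS; congr (_ ^ _); lia.
  apply: triple_assign => //=; try lia; rewrite nx.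
    by apply: leq_trans PW; rewrite leq_pexp2l ?leq_subr //; lia.
  by split=> //; lia.
move=> s2 b2 f2 [_]; rewrite subn0 -/P0 => s2P.
have cs2 : ctx G s2 by apply: (ctx_frame f2).
have s2D : s2 11 0 = D by rewrite f2.
apply: (@triple_assign_seq _ 12 ((K + 1) * (sim_time + 54) + 32)) => //=; try lia.
  by rewrite s2P; case: cs2 => ->.
rewrite s2P (proj1 cs2) -/K => b3.
apply: (@triple_assign_seq _ 4 ((K + 1) * (sim_time + 54) + 28)) => //=; try lia; move=> b4.
apply: (@triple_assign_seq _ 4 ((K + 1) * (sim_time + 54) + 24)) => //=; try lia; move=> b5.
set s5 := update _ 16 _ _.
have cs5 : ctx G s5 by []. have s5D : s5 11 0 = D by [].
pose res c := (sim G D (c %% n) (c %/ n)).1.2.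
(* An inequality for the stored code: before any improvement both the size and the code are 0, while
   the code 0 itself may give more. *)
pose R i (s6 : state) := s6 15 0 <= size (res (s6 16 0)) /\
  forall c, i <= c < K -> size (res c) <= s6 15 0.
apply: (@triple_seq _ _ _ (K * (sim_time + 40 + 14) + 10) (sim_time + 6) _ _ (R 0));
  last by lia.
  apply: (@triple_for W 14 (Var 22) _ (sim_time + 40) _ K R) => //=; try lia.
    by split=> // c; lia.
  move=> i s6 iK b6 f6 [R1 R2].
  have bu : bounded W (update s6 14 0 i) by apply: bounded_update => //; lia.
  apply: (@triple_assign_seq _ 6 (sim_time + 34)) => //=; try lia.
  rewrite [update _ 14 _ _ _ _]/= => b7; set s7 := update _ 20 _ _.
  have cs7 : ctx G s7 by apply: (ctx_frame f6).
  have s7D : s7 11 0 = D by rewrite /s7 /update /= f6.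
  have s7i : s7 20 0 = i by []. have {}b7 : bounded W s7 by [].
  apply: (triple_seq (triple_sim W3 nW n1W b7 cs7 s7D n0) (T2 := 22)); last first.
    by rewrite /sim_time; lia.
  move=> s8 b8 f8 /=; rewrite s7i => -[_ s8s _ _].
  have e15 : s8 15 0 = s6 15 0 by rewrite f8.
  have e16 : s8 16 0 = s6 16 0 by rewrite f8.
  have e20 : s8 20 0 = i by rewrite f8.
  apply: (@triple_if _ _ _ _ 12) => //=; rewrite s8s e15 -/(res i) => cmp.
    apply: (@triple_assign_seq _ 6 6) => //= b9; apply: triple_assign => //=.
    have z15 : update (update s8 15 0 (s8 8 0)) 16 0 (update s8 15 0 (s8 8 0) 20 0) 15 0 =
      size (res i) by rewrite /update /= s8s.
    have z16 : update (update s8 15 0 (s8 8 0)) 16 0 (update s8 15 0 (s8 8 0) 20 0) 16 0 =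
      i by rewrite /update /= e20.
    rewrite /R z15 z16; split=> // c /andP[]; rewrite leq_eqVlt => /predU1P[<- //|ic cK].
    by have := R2 c; rewrite ic cK => /(_ isT); lia.
  apply: triple_skip => //; rewrite /R e15 e16; split=> // c /andP[].
  rewrite leq_eqVlt => /predU1P[<- _|ic cK]; first by rewrite -subn_eq0 cmp.
  by apply: R2; rewrite ic cK.
move=> s6 b6 f6 [R1 R2].
apply: (@triple_assign_seq _ 6 sim_time) => //=; try lia.
move=> b7; set s7 := update _ 20 _ _.
have cs7 : ctx G s7 by apply: (ctx_frame f6).
have s7D : s7 11 0 = D by rewrite /s7 /update /= f6.
have s7c : s7 20 0 = s6 16 0 by [].
have {}b7 : bounded W s7 by [].
apply: triple_conseq (triple_sim W3 nW n1W b7 cs7 s7D n0) (leqnn _) _.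
move=> s8 b8 f8 /=; rewrite s7c => st8; eexists; eexists; split; first exact: st8.
have [p [m [pn mP]]] := sim_approx deg D1 n0 b0 ba.
rewrite -/e -/P0 in mP * => h; apply: leq_trans h _; rewrite leq_mul2l.
(* The good pair of starting point and choices is packed as [m * n + p], which is below [K]. *)
have := R2 (m * n + p); rewrite /res modnMDl divnMDl // modn_small // divn_small // addn0.
have -> : 0 <= m * n + p < K by rewrite /K -/P0; nia.
by move=> /(_ isT) h; apply/orP; right; apply: leq_trans h R1.
Qed.

Lemma triple_approx a b s :
  let D := maxdeg G in let e := (b * n %/ a + 3) %/ 2 in
  let K := (2 * D) ^ e * n in
  a <= W -> b <= W -> e <= W -> K <= W -> 0 < b -> b <= a ->
  bounded W s -> ctx G s -> stores G [::] set0 s ->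
  triple W (approx_prog a b)
    (n * (50 * n + 60) + 30 +
     if D <= 2 then n * (n * (110 * n + 200) + 80) + 10
     else 31 * e + (K + 1) * (sim_time + 54) + 80) s
    (fun s1 => exists E X, stores G E X s1 /\
       if D <= 2 then max_induced_matching G <= size E
       else b * max_induced_matching G <= a * size E).
Proof.
move=> D e K aW bW eW KW b0 ba Ws cs st; have [_ _ bl _] := st.
set T := if _ then _ else _.
apply: (triple_seq (triple_maxdeg Ws cs bl) (T2 := T + 8)); last by lia.
move=> s1 b1 f1 s1D.
have cs1 : ctx G s1 by apply: (ctx_frame f1).
have st1 : stores G [::] set0 s1 by rewrite /stores /blocks !f1.
apply: (@triple_if _ _ _ _ T) => //=; try lia; rewrite s1D -/D => cmp.
  have D2 : (D <= 2) = false by rewrite -subn_eq0; apply: negPf.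
  rewrite /T D2; apply: triple_search => //; rewrite -/D; lia.
have D2 : D <= 2 by rewrite -subn_eq0 cmp.
rewrite /T D2; apply: triple_greedy => // v; apply: leq_trans D2.
exact: (leq_bigmax (F := fun v => #|[set u | G v u]|)).
Qed.

End Algorithms.

(** * Correctness and running time *)

Lemma ctx_input n (G : sgraph n) : ctx G (input G).
Proof.
split=> // u v /=; congr nat_of_bool; apply/existsP/idP.
  by move=> [u' /existsP[v' /andP[/eqP/cell_inj[-> ->]]]].
by move=> uv; exists u; apply/existsP; exists v; rewrite eqxx.
Qed.

Lemma stores_input n (G : sgraph n) : stores G [::] set0 (input G).
Proof.
by split=> //= [v|]; [rewrite inE | apply/subsetP => v; rewrite inE].
Qed.

Lemma bounded_input n (G : sgraph n) W : 0 < W -> n <= W -> bounded W (input G).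
Proof.
move=> W0 nW [|[|a]] k //=; first by case: ifP.
by case: existsP.
Qed.

Lemma output_stores n (G : sgraph n) E X s : stores G E X s -> output n s = edge_set E.
Proof.
move=> [h _ _ _]; rewrite /output /edge_set; apply/setP => e.
apply/imsetP/imsetP => -[[u v]] /=; rewrite ?inE ?h => p ->; exists (u, v) => //.
by rewrite inE h.
Qed.

Lemma maxdeg_le n (G : sgraph n) : maxdeg G <= n.
Proof. by apply/bigmax_leqP => v _; rewrite -[X in _ <= X](card_ord n) max_card. Qed.

Lemma bitlen_le W m : 0 < W -> W <= 2 ^ m -> bitlen W <= m.+1.
Proof.
by move=> W0 Wm; rewrite ltnS -(leq_exp2l _ _ (ltnSn 1)); apply: leq_trans Wm; apply: trunc_logP.
Qed.

Lemma approx_prog_correct a b n (G : sgraph n) : 0 < b -> b <= a ->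
  let D := maxdeg G in let e := (b * n %/ a + 3) %/ 2 in
  exists t s, [/\ exec (approx_prog a b) (input G) t s, induced_matching G (output n s),
    if D <= 2 then max_induced_matching G <= #|output n s|
    else b * max_induced_matching G <= a * #|output n s|
  & t <= 500 * (a + b + 11) * n.+1 ^ 6 * (if D <= 2 then 1 else (2 * D) ^ e)].
Proof.
move=> b0 ba D e; set K := (2 * D) ^ e * n.
(* All cells stay below [W]: codes are below [K], and the other terms cover matrix indices, counters
   and literals. *)
pose W := K + (n * n + n + a + b + e + 4).
have [w1 w2 w3 w4 w5] : [/\ 3 < W, n * n < W, n < W, a <= W & b <= W].
  by rewrite /W; split; lia.
have [w6 w7] : e <= W /\ K <= W by rewrite /W; split; lia.
have bi : bounded W (input G) by apply: bounded_input; lia.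
have [t [s [ex ht _ [E [X [st hE]]]]]] :=
  triple_approx w1 w2 w3 w4 w5 w6 w7 b0 ba bi (ctx_input G) (stores_input G).
exists t, s; have [_ _ _ /andP[/imatching_induced[h1 h2 _] _]] := st.
rewrite (output_stores st) h2; split=> //.
apply: leq_trans ht _.
have e_le : e <= n + 2.
  have : b * n %/ a <= n.
    by rewrite -[X in _ <= X](@mulKn n a) ?leq_div2r ?leq_mul2r ?ba ?orbT //; lia.
  by rewrite /e; lia.
have Dn : D <= n := maxdeg_le G.
(* Since [D <= 2 ^ n] and [e <= n + 2], the number [K] is at most 2 to a quadratic power of [n];
   hence its bit length is polynomial. *)
have bitW : bitlen W <= (a + b + 11) * n.+1 ^ 2.
  apply: (@leq_trans ((n + 1) * e + n + (n * n + n + a + b + e + 4) + 1).+1).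
    apply: bitlen_le; first by rewrite /W; lia.
    rewrite addn1 expnS mul2n -addnn /W leq_add //.
      apply: (@leq_trans (2 ^ ((n + 1) * e + n))); last by rewrite leq_exp2l // leq_addr.
      rewrite expnD /K leq_mul // ?(ltnW (ltn_expl _ _)) // expnM.
      case: (e) => // e'; rewrite leq_exp2r // addn1 expnS leq_mul2l /=.
      by apply: leq_trans Dn _; apply/ltnW/ltn_expl.
    apply: leq_trans (ltnW (ltn_expl _ (ltnSn 1))) _.
    by rewrite leq_exp2l // leq_addl.
  rewrite expnS expn1 mulnDl.
  have : a + b <= (a + b) * (n.+1 * n.+1) by rewrite leq_pmulr.
  have : (n + 2) * e <= (n + 2) * (n + 2) by rewrite leq_mul2l e_le orbT.
  have -> : n.+1 * n.+1 = n * n + 2 * n + 1 by lia.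
  move: (_ * (_ + 1)) => c; rewrite !mulnDl !mulnDr; lia.
(* The sixth power splits into a fourth power for the step count and a square for [bitlen W]. *)
have -> : 500 * (a + b + 11) * n.+1 ^ 6 * (if D <= 2 then 1 else (2 * D) ^ e) =
  (500 * n.+1 ^ 4 * (if D <= 2 then 1 else (2 * D) ^ e)) * ((a + b + 11) * n.+1 ^ 2).
  by rewrite (expnD _ 4 2); lia.
apply: leq_mul => //.
have n4 : n.+1 ^ 4 = n.+1 * n.+1 * n.+1 * n.+1 by rewrite !expnS expn0 muln1 !mulnA.
rewrite n4 {n4}; case: ifP => D2; first by rewrite muln1; clear; nia.
set P := (2 * D) ^ e.
have P0 : 0 < P by rewrite expn_gt0; apply/orP; left; lia.
have simN : sim_time n + 54 <= 200 * (n.+1 * n.+1 * n.+1).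
  by rewrite /sim_time; clear; nia.
have KP : K + 1 <= P * n.+1 by rewrite /K -/P mulnS addnC leq_add.
have := leq_mul KP simN.
have : n * (50 * n + 60) + 30 + (31 * e + 80) <= 300 * (n.+1 * n.+1).
  by move: e_le; clear; nia.
have : 300 * (n.+1 * n.+1) <= 300 * (n.+1 * n.+1 * n.+1 * n.+1) * P.
  have -> : 300 * (n.+1 * n.+1 * n.+1 * n.+1) * P =
    300 * ((n.+1 * n.+1) * (n.+1 * n.+1 * P)) by clear; lia.
  by rewrite leq_mul2l leq_pmulr // !muln_gt0.
rewrite -/D -/e -/K; move: (n.+1) (sim_time n) => N S; lia.
Qed.

(** * The bound over the reals *)

From mathcomp Require Import all_classical all_reals all_analysis.
From mathcomp Require Import ring lra.

Import Order.TTheory GRing.Theory Num.Theory.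
Local Open Scope ring_scope.

Lemma powR_log2 (R : realType) (x d : R) : 2 `^ (x * log2 d) = expR (x * ln d).
Proof.
have ln2 : ln (2 : R) != 0 by rewrite gt_eqF // ln_gt0 // ltr1n.
by rewrite /powR pnatr_eq0 /= /log2 -!mulrA mulVf ?mulr1.
Qed.

(** For [a] the integer part of [10 * r], the ratio [a / 10] is the rational approximation of [r]
    from below: [10 * r < a + 1] and [10 <= a] give the factor 11/10. *)
Lemma truncn10 (R : realType) (r : R) : 1 <= r ->
  [/\ (10 <= Num.truncn (10 * r))%N, (Num.truncn (10 * r))%:R <= 10 * r
    & 100 * r <= 11 * (Num.truncn (10 * r))%:R].
Proof.
move=> r1; have r10 : 0 <= 10 * r by lra.
have /andP[h1 h2] := truncn_itv r10.
have a10 : (10 <= Num.truncn (10 * r))%N by rewrite truncn_ge_nat //; lra.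
split=> //; have : 10%:R <= (Num.truncn (10 * r))%:R :> R by rewrite ler_nat.
move: h2; rewrite -natr1; lra.
Qed.

(* For [d >= 3] one has [(2 d)^11 <= d^20]. *)
Lemma expn_le_expR (R : realType) (r : R) (a n d : nat) :
  0 < r -> (0 < a)%N -> 100 * r <= 11 * a%:R -> (2 < d)%N ->
  (((2 * d) ^ ((10 * n %/ a + 3) %/ 2))%N%:R : R)
    <= ((2 * d) ^ 2)%N%:R * expR (n%:R / r * ln d%:R).
Proof.
move=> r0 a0 ra d2; set e := (_ %/ 2)%N.
have ea : (a * (2 * e) <= 10 * n + 3 * a)%N.
  have : (a * (10 * n %/ a) <= 10 * n)%N by rewrite mulnC leq_trunc_div.
  have : (2 * e <= 10 * n %/ a + 3)%N by rewrite mulnC leq_trunc_div.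
  by move: (10 * n %/ a)%N e => q e h1 h2; nia.
have {}ea : a%:R * (2 * e%:R) <= 10 * n%:R + 3 * a%:R :> R.
  by rewrite -!natrM -natrD ler_nat.
have aR : 0 < a%:R :> R by rewrite ltr0n.
have dR : 0 < d%:R :> R by rewrite ltr0n (leq_trans _ d2).
have xR : 0 < (2 * d)%N%:R :> R by rewrite ltr0n muln_gt0 (leq_trans _ d2).
have lnx0 : 0 <= ln (2 * d)%N%:R :> R by rewrite ln_ge0 // ler1n muln_gt0 (leq_trans _ d2).
have lnd0 : 0 <= ln d%:R :> R by rewrite ln_ge0 // ler1n (leq_trans _ d2).
have lnxd : 11 * ln (2 * d)%N%:R <= 20 * ln d%:R :> R.
  have : ((2 * d) ^ 11 <= d ^ 20)%N.
    (* It suffices that [2 ^ 11 <= 3 ^ 9]. *)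
    rewrite expnMn (expnD d 9 11) leq_mul2r; apply/orP; right.
    by apply: (@leq_trans (3 ^ 9)%N); rewrite ?leq_exp2r.
  rewrite -(ler_nat R) !natrX => h.
  have : ln ((2 * d)%N%:R ^+ 11) <= ln (d%:R ^+ 20) :> R by rewrite ler_ln ?posrE ?exprn_gt0.
  by rewrite !lnXn // -!(mulr_natl (ln _)).
rewrite !natrX -[X in X ^+ e]lnK ?posrE // -[X in _ <= X ^+ 2 * _]lnK ?posrE //.
rewrite -!expRM_natl -expRD ler_expR -lerBlDl -mulrBl.
have n0 : 0 <= n%:R :> R by rewrite ler0n.
(* The rounding in [e] costs at most 3/2 in the exponent, which the separate factor [(2 * d) ^ 2]
   absorbs. *)
have e_le : e%:R - 2%:R <= 5 * n%:R / a%:R :> R by rewrite ler_pdivlMr //; lra.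
apply: le_trans (_ : 5 * n%:R / a%:R * ln (2 * d)%N%:R <= _); first exact: ler_wpM2r.
apply: le_trans (_ : 5 * n%:R / a%:R * (20 / 11 * ln d%:R) <= _).
  by apply: ler_wpM2l; [rewrite divr_ge0 // mulr_ge0 // ltW | lra].
(* What remains is [100 * n / (11 * a) <= n / r], which is the hypothesis [ra]. *)
rewrite mulrA ler_wpM2r // ler_pdivlMr // mulrAC -mulrA mulrAC.
rewrite ler_pdivrMr // -mulrA -subr_ge0.
nra.
Qed.

Theorem theorem5p12 (R : realType) (r : R) (hr : 1 <= r) :
  exists (A : prog) (p : {poly R}),
    approx_algorithm r A
      (fun n D : nat => 2 `^ (n%:R / r * log2 D%:R) * p.[n%:R]).
Proof.
have [a10 ar ra] := truncn10 hr; set a := Num.truncn (10 * r) in a10 ar ra.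
(* The factor 4 and two of the eight powers come from [(2 * D) ^ 2 <= 4 * N ^ 2]; the rest is the
   bound of [approx_prog_correct] with [b = 10]. *)
pose c := (2000 * (a + 10 + 11))%N.
exists (approx_prog a 10), (c%:R *: ('X + 1) ^+ 8) => n G.
have [t [s [ex hM hap ht]]] := @approx_prog_correct a 10 n G isT a10.
exists t, s; split=> //.
- split=> //; case: ifP hap => _ hap.
    apply: le_trans (_ : #|output n s|%:R <= _); first by rewrite ler_nat.
    by rewrite ler_peMl.
  move: hap; rewrite -(ler_nat R) !natrM => hap.
  have : a%:R * #|output n s|%:R <= 10 * r * #|output n s|%:R by rewrite ler_wpM2r.
  by move=> h; rewrite -(@ler_pM2l _ 10%:R) //; apply: le_trans hap _; rewrite mulrA.
rewrite powR_log2 hornerZ horner_exp hornerD hornerX hornerC natr1.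
set N := n.+1; set D := maxdeg G in ht *.
set x := expR _.
set y := (if _ then _ else _) in ht.
have key : y%:R <= 4 * N%:R ^+ 2 * x.
  have N1 : 1 <= N%:R :> R by rewrite ler1n.
  rewrite /y; case: ifP => D2.
    have x1 : 1 <= x.
      rewrite -expR0 ler_expR mulr_ge0 //; first by rewrite divr_ge0 // ltW // (lt_le_trans ltr01).
      (* For an edgeless graph, [ln 0 = 0] makes the exponent 0. *)
      by case: (D) => [|d]; [rewrite ln0 | rewrite ln_ge0 // ler1n].
    have : 1 <= N%:R ^+ 2 :> R by rewrite exprn_ege1.
    by move=> ?; nra.
  have r0 : 0 < r by lra.
  have a0 : (0 < a)%N by apply: leq_trans a10.
  apply: le_trans (expn_le_expR n r0 a0 ra _) _; first by rewrite ltnNge D2.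
  apply: ler_wpM2r; first exact: expR_ge0.
  rewrite expnMn natrM natrX; apply: ler_pM => //.
  by rewrite natrX lerXn2r ?nnegrE // ler_nat ltnW // ltnS maxdeg_le.
have : t%:R <= (500 * (a + 10 + 11) * N ^ 6)%N%:R * (4 * N%:R ^+ 2 * x).
  apply: le_trans (_ : _ <= (500 * (a + 10 + 11) * N ^ 6)%N%:R * _ ) _; last first.
    by apply: ler_wpM2l key; rewrite ler0n.
  by rewrite -natrM ler_nat.
move/le_trans; apply; rewrite le_eqVlt; apply/orP; left; apply/eqP.
rewrite [(_ * N ^ 6)%N%:R]natrM natrX /c !natrM; ring.
Qed.
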